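(* In the setting below, the ring $H^*(\mathcal G(EIII))$ of GKM functions is generated as an $H^*(BT)$-algebra by the two GKM functions $\tau$ and $\omega$.
   Context: Identify the dual of the Lie algebra of a maximal torus $T$ of $E_6$ with $\{\sum_{i=1}^8x_ie_i\in\mathbb R^8: x_6=x_7=-x_8\}$ with the standard inner product; write $E=e_8-e_7-e_6$. Simple roots: $\alpha_1=\frac12(e_1-e_2-e_3-e_4-e_5-e_6-e_7+e_8)$, $\alpha_2=e_1+e_2$, $\alpha_i=e_{i-1}-e_{i-2}$ ($3\le i\le6$); $\Phi(E_6)=\{\pm(e_i\pm e_j)\ (1\le i<j\le5)\}\cup\{\pm\frac12(\sum_{k=1}^5\mu_ke_k+E):\mu_k=\pm1,\prod\mu_k=1\}$. $H^*(BT)=H^*(BT;\mathbb Z)$ is the symmetric algebra over $\mathbb Z$ on the lattice $H^2(BT)$ spanned by $t_0=\frac12\sum_{i=1}^5e_i-\frac16E$, $t_i=e_i+\frac13E$ ($1\le i\le5$), $x=\frac12(\sum_{i=1}^5e_i+E)$, graded with $H^2$ in degree 2. $W(D_5)\subset W(E_6)$ is generated by the reflections of $\alpha_2,\dots,\alpha_6$; $\bar t=\frac23E$ is fixed by $W(D_5)$; $\Lambda=W(E_6)\cdot\bar t$ consists of the 27 elements $\bar t$; $\frac12\sum_{i=1}^5\mu_ie_i+\frac16E$ with $\mu_i=\pm1$, $\prod\mu_i=-1$; and $\pm e_j-\frac13E$ ($1\le j\le5$). For $\lambda\in\Lambda$ fix $\rho_\lambda\in W(E_6)$ with $\rho_\lambda(\bar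 t)=\lambda$; the vertex $\rho_\lambda W(D_5)$ is written $\rho_\lambda$. The GKM graph $\mathcal G(EIII)$ has vertex set $W(E_6)/W(D_5)$ and for distinct vertices $vW(D_5)\ne wW(D_5)$ and each positive root $\alpha$ with $\sigma_\alpha vW(D_5)=wW(D_5)$ an edge labelled $(\alpha)$; $H^*(\mathcal G(EIII))$ is the ring of functions $f$ from the vertices to $H^*(BT)$ with $f(u)-f(v)\in(\alpha)$ for every edge labelled $(\alpha)$ between $u,v$. Define $\tau(\rho_\lambda)=\bar t-\lambda$, and define $\omega$ (of degree 8) by, with $\mathbf e=\{e_1,\dots,e_5\}$, $c_i$ the elementary symmetric polynomials, $S=\frac12\sum_{i=1}^5e_i$: $\omega(\rho_{\bar t})=0$; $\omega(\rho_\lambda)=0$ for $\lambda=-e_n+S+\frac16E$; $\omega(\rho_\lambda)=(e_l+e_m)(e_m+e_n)(e_n+e_l)(\bar t-\lambda)$ for $\lambda=-e_l-e_m-e_n+S+\frac16E$ ($l,m,n$ distinct); $\omega(\rho_\lambda)=(\bar t-\lambda)(c_1(\mathbf e)c_2(\mathbf e)-c_3(\mathbf e))$ for $\lambda=-S+\frac16E$; $\omega(\rho_\lambda)=\prod_{n\ne j}(-e_n+S+\frac16E-\lambda)$ for $\lambda=e_j-\frac13E$; and for $\lambda=-e_j-\frac13E$, $\omega(\rho_\lambda)=(S+\frac12E)\bigl\{\prod_{n\ne j,k}(-e_n-e_k+S+\frac12E)+(e_j+e_k)(\bar t-\lambda)(-e_k+S+\frac12E)\bigr\}$, where $k\in\{1,\dots,5\}$,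 $k\ne j$. (These $\tau,\omega$ are GKM functions on $\mathcal G(EIII)$.)
   Formalization: In ω(ρ_λ) for λ = −e_j − E/3 the last factor (−e_k + S + ½E) is replaced by (−e_k + S + E/6 − λ) = (e_j − e_k + S + ½E); with the printed factor ω depends on k and is not a GKM function. *)

(* Defs.v *)
From HB Require Import structures.
From mathcomp Require Import all_boot all_order all_algebra.
From mathcomp Require Import mpoly.
Set Implicit Arguments. Unset Strict Implicit. Unset Printing Implicit Defensive.
Import Order.TTheory GRing.Theory Num.Theory.
Local Open Scope ring_scope.

(* The space V = { x in R^8 : x6 = x7 = -x8 } (over Q, which suffices since *)
(* everything is rational).  A vector  sum_{i<=5} x_i e_i + c E  (with      *)
(* E = e8 - e7 - e6) is encoded as the row (x1,...,x5,c) : 'rV[rat]_6.      *)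
Definition vec := 'rV[rat]_6.

(* e_{i+1}, for i : 'I_5 *)
Definition ev (i : 'I_5) : vec := \row_(k < 6) (if (k == i :> nat) then 1 else 0).
(* E = e8 - e7 - e6 *)
Definition EE : vec := \row_(k < 6) (if (k == 5%N :> nat) then 1 else 0).

(* standard inner product of R^8 restricted to V: (E,E) = 3, (E,e_i) = 0 *)
Definition dot (u v : vec) : rat :=
  \sum_(k < 6) (if (k == 5%N :> nat) then 3 else 1) * u 0 k * v 0 k.

Definition Ssum : vec := (1/2) *: \sum_(i < 5) ev i.
Definition tbar : vec := (2/3) *: EE.

Definition signs := {ffun 'I_5 -> bool}.
Definition sgn (s : signs) (i : 'I_5) : rat := if s i then 1 else -1.
Definition halfsum (s : signs) : vec := \sum_(i < 5) (sgn s i / 2) *: ev i.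
(* set of indices with mu_i = -1; prod mu_i = (-1)^#|negs s| *)
Definition negs (s : signs) : {set 'I_5} := [set i | ~~ s i].

(* Lambda = W(E6).tbar, the 27 elements listed in the paper *)
Definition inLambda (v : vec) : bool :=
  [|| v == tbar,
      [exists s : signs, odd #|negs s| && (v == halfsum s + (1/6) *: EE)]
    | [exists j : 'I_5, (v == ev j - (1/3) *: EE) || (v == - ev j - (1/3) *: EE)]].

(* Positive roots of E6 w.r.t. the simple roots alpha_1..alpha_6 of the paper:
   e_j + e_i, e_j - e_i (1 <= i < j <= 5) and
   1/2 (sum mu_k e_k + E) with prod mu_k = 1. *)
Definition posRoot (a : vec) : bool :=
  [exists i : 'I_5, exists j : 'I_5,
      (i < j)%N && ((a == ev j + ev i) || (a == ev j - ev i))]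
  || [exists s : signs, ~~ odd #|negs s| && (a == halfsum s + (1/2) *: EE)].

Definition refl (a v : vec) : vec := v - ((2 * dot v a) / dot a a) *: a.

(* edges of the GKM graph G(EIII), vertices rho_lambda W(D5) being identified
   with lambda = rho_lambda(tbar) in Lambda: an edge labelled (alpha) joins
   lambda and mu when lambda <> mu and sigma_alpha lambda = mu. *)
Definition edge (u v a : vec) : bool :=
  [&& inLambda u, inLambda v, u != v, posRoot a & refl a u == v].

(* H^*(BT): the symmetric algebra over Z on the lattice H^2(BT) spanned by  *)
(* t0,...,t5,x, realized inside Sym_Q(V) = Q[X_0..X_5] where X_{i} stands   *)
(* for e_{i+1} (i<5) and X_5 for E; Sym_Z(L) embeds in Sym_Q(V) as the      *)
(* Z-subalgebra generated by L.                                             *)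
Notation P := {mpoly rat[6]}.

Definition lin (v : vec) : P := \sum_(k < 6) v 0 k *: 'X_k.

Definition t0 : vec := Ssum - (1/6) *: EE.
Definition ti (i : 'I_5) : vec := ev i + (1/3) *: EE.
Definition xg : vec := Ssum + (1/2) *: EE.

Definition lattice_gen (v : vec) : Prop :=
  v = t0 \/ (exists i : 'I_5, v = ti i) \/ v = xg.

Inductive HBT : P -> Prop :=
  | HBT_gen v : lattice_gen v -> HBT (lin v)
  | HBT_1 : HBT 1
  | HBT_add p q : HBT p -> HBT q -> HBT (p + q)
  | HBT_opp p : HBT p -> HBT (- p)
  | HBT_mul p q : HBT p -> HBT q -> HBT (p * q).

(* GKM functions: vertex functions are encoded as maps vec -> P whose values
   matter only on Lambda. *)
Definition GKM (f : vec -> P) : Prop :=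
  (forall v, inLambda v -> HBT (f v)) /\
  (forall u v a, edge u v a -> exists g, HBT g /\ f u - f v = lin a * g).

Definition tau (v : vec) : P := lin (tbar - v).

Definition esym (k : nat) : P :=
  \sum_(A : {set 'I_5} | #|A| == k) \prod_(i in A) lin (ev i).

(* lambda = halfsum s + 1/6 E  with #|negs s| odd (1, 3 or 5) *)
Definition omega_odd (s : signs) (v : vec) : P :=
  let N := negs s in
  if #|N| == 1%N then 0
  else if #|N| == 3%N then
    (\prod_(a in N) \prod_(b in N | (a < b)%N) lin (ev a + ev b)) * tau v
  else tau v * (esym 1 * esym 2 - esym 3).

Definition omega_pos (j : 'I_5) (v : vec) : P :=
  \prod_(n < 5 | n != j) lin (- ev n + Ssum + (1/6) *: EE - v).

(* lambda = - e_j - 1/3 E, with the fixed choice k = 2 if j = 1, else k = 1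
   (1-based). *)
Definition omega_neg (j : 'I_5) (v : vec) : P :=
  let k : 'I_5 := if (j == 0%N :> nat) then inord 1 else inord 0 in
  let xE := Ssum + (1/2) *: EE in
  lin xE *
  (\prod_(n < 5 | (n != j) && (n != k)) lin (- ev n - ev k + xE)
   + lin (ev j + ev k) * tau v * lin (- ev k + Ssum + (1/6) *: EE - v)).

Definition omega (v : vec) : P :=
  if v == tbar then 0 else
  match [pick s : signs | odd #|negs s| && (v == halfsum s + (1/6) *: EE)] with
  | Some s => omega_odd s v
  | None =>
    match [pick j : 'I_5 | v == ev j - (1/3) *: EE] with
    | Some j => omega_pos j v
    | None =>
      match [pick j : 'I_5 | v == - ev j - (1/3) *: EE] with
      | Some j => omega_neg j v
      | None => 0
      end
    end
  end.

(* Main.v *)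
Require Import Defs.
From HB Require Import structures.
From mathcomp Require Import all_boot all_order all_algebra.
From mathcomp Require Import mpoly ring lra.
Set Implicit Arguments. Unset Strict Implicit. Unset Printing Implicit Defensive.
Import GRing.Theory.
Local Open Scope ring_scope.

(* The 27 vertices are the weights A_i = x - t_i, C_ij = t_i + t_j - x and      *)
(* B_i = - t_i (0 <= i, j <= 5), adjacent when they differ by a root.  Distinct *)
(* roots are coprime in H^*(BT), so a GKM function vanishing on all vertices    *)
(* before v is divisible at v by the product of the labels of the edges going   *)
(* down from v.  Hence it suffices to exhibit, for each vertex v, an element of *)
(* the algebra generated by tau and omega which vanishes on the vertices before *)
(* v and takes that product as value at v.  With sigma = tbar - tau, the value  *)
(* of sigma at v is v itself.                                                   *)
(* - At A_k, take prod_(i < k) (sigma - A_i).                                   *)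
(* - omega vanishes on the A_i, omega(C_ij) = prod_(n <> i, j) (A_n - C_ij) is  *)
(*   monic quadratic in p = t_i t_j, and prod_i (sigma - A_i) equals            *)
(*   omega (z^2 - z s + p) on the C_ij, for s = t_i + t_j = sigma + x and       *)
(*   z = 2 x - s.  So omega F(s, p) lifts to the algebra for every polynomial   *)
(*   F; take F = prod_(l < i) (p - s t_l + t_l^2) prod_(i < l < j) (s - t_i - t_l). *)
(* - Lifting p omega, p^2 omega, p^3 omega and using the relations of the       *)
(*   Grassmannian Gr(2,6) gives a class vanishing on all A_i and C_ij whose     *)
(*   value at B_k is minus the product of the labels towards them; multiply it  *)
(*   by prod_(i < k) (sigma - B_i).                                             *)

(** * Coordinates *)

(** With the vertices in the order A_i, then C_ij lexicographically, then B_i, a GKM function is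
    cleared one vertex at a time. [flow_criterion] is this induction: if [f] agrees with an element
    of the algebra on the earlier vertices, their difference at the next vertex is divisible by
    every label going down, hence by the product of these labels ([root_prod_dvd], an integral Gauss
    lemma), so a multiple of the flow-up class at that vertex removes it. The flow-up classes come
    from [flow_VA], [flow_VC] and [flow_VB].

    Two generators suffice because the C_ij with their edges form the GKM graph of Gr(2,6), where
    functions are polynomials in s = t_i + t_j and p = t_i t_j. The variable s comes from tau. The
    variable p is reached only after multiplication by omega ([pomega]), and since omega is itself
    quadratic in p, the products of omega with higher powers of p follow ([liftable_scale_p]). The
    relations of Gr(2,6) then give a class that survives only on the B_k ([last_cls_VC],
    [last_cls_VB]).

    That omega is a GKM function rests on [omega_wt], which puts its values in a form symmetric in
    t_0, ..., t_5; the edge conditions become a few polynomial identities ([omv_dvd]). *)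

Definition crd := seq rat.
Definition addc (l m : crd) : crd := mkseq (fun i => l`_i + m`_i) 6.
Definition scalec (c : rat) (l : crd) : crd := mkseq (fun i => c * l`_i) 6.
Definition subc (l m : crd) : crd := addc l (scalec (-1) m).
Definition dotc (l m : crd) : rat :=
  foldr (fun i r => (if (i == 5%N)%N then 3 else 1) * l`_i * m`_i + r) 0 (iota 0 6).
(** Vectors are mirrored by lists of rationals so that finite statements about the 27 weights and
    the 72 roots can be decided by evaluation. *)
Definition vecc (l : crd) : vec := \row_k l`_k.

Lemma vec_eq (u v : vec) :
  (forall i, (i < 6)%N -> u 0 (inord i) = v 0 (inord i)) -> u = v.
Proof. by move=> H; apply/rowP => k; have := H k (ltn_ord k); rewrite inord_val. Qed.

Lemma vD (u v : vec) k : (u + v) 0 k = u 0 k + v 0 k.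
Proof. by rewrite mxE. Qed.

Lemma vZ c (u : vec) k : (c *: u) 0 k = c * u 0 k.
Proof. by rewrite mxE. Qed.

Lemma veccE l (i : nat) : (i < 6)%N -> vecc l 0 (inord i) = l`_i.
Proof. by move=> hi; rewrite mxE inordK. Qed.

Lemma vecc_add l m : vecc (addc l m) = vecc l + vecc m.
Proof. by apply/rowP=> k; rewrite !mxE nth_mkseq. Qed.

Lemma vecc_scale c l : vecc (scalec c l) = c *: vecc l.
Proof. by apply/rowP=> k; rewrite !mxE nth_mkseq. Qed.

Lemma vecc_sub l m : vecc (subc l m) = vecc l - vecc m.
Proof. by rewrite vecc_add vecc_scale scaleN1r. Qed.

Lemma dotcE l m : dot (vecc l) (vecc m) = dotc l m.
Proof. by rewrite /dot !big_ord_recl big_ord0 !mxE. Qed.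

Lemma dotDl u v w : dot (u + v) w = dot u w + dot v w.
Proof. by rewrite /dot -big_split /=; apply: eq_bigr => k _; rewrite mxE; ring. Qed.

Lemma dotZl c u w : dot (c *: u) w = c * dot u w.
Proof. by rewrite /dot mulr_sumr; apply: eq_bigr => k _; rewrite mxE; ring. Qed.

Lemma dotC u w : dot u w = dot w u.
Proof. by apply: eq_bigr => k _; ring. Qed.

Lemma dot0l w : dot 0 w = 0.
Proof. by rewrite -(scale0r 0) dotZl mul0r. Qed.

Lemma linD u v : lin (u + v) = lin u + lin v.
Proof.
by rewrite /lin -big_split; apply: eq_bigr => k _; rewrite mxE scalerDl.
Qed.

Lemma linZ c v : lin (c *: v) = c *: lin v.
Proof. by rewrite /lin scaler_sumr; apply: eq_bigr => k _; rewrite mxE scalerA. Qed.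

Lemma linN v : lin (- v) = - lin v.
Proof. by rewrite -scaleN1r linZ scaleN1r. Qed.

Lemma linB u v : lin (u - v) = lin u - lin v.
Proof. by rewrite linD linN. Qed.

Lemma lin_eq0 v : lin v = 0 -> v = 0.
Proof.
move=> h; apply/rowP => k; rewrite mxE.
have: (lin v)@_(U_(k)%MM) = 0 by rewrite h mcoeff0.
rewrite /lin linear_sum /= (bigD1 k) //= big1 => [|j /negPf jk].
  by rewrite mcoeffZ mcoeffX eqxx mulr1 addr0.
by rewrite mcoeffZ mcoeffX eq_mnm1 jk mulr0.
Qed.

(** * The weights in terms of t_0, ..., t_5 and x *)

(** Putting t_0 in one family with the other t_i exposes the symmetry under permutations of six
    indices. The [inord] gives a default value past index 5, whence the bounds [i < 6] below. *)
Definition tv (i : nat) : vec := if i is k.+1 then ti (inord k) else t0.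

Definition tc (i : nat) : crd :=
  if i is k.+1 then mkseq (fun n => if n == 5%N then 1/3 else (n == k)%:R) 6
  else mkseq (fun n => if n == 5%N then - (1/6) else 1/2) 6.
Definition xc : crd := nseq 6 (1/2).

(* Named after the 27 lines on a cubic surface: [VA i] is x - t_i, [VC i j] *)
(* is t_i + t_j - x, and [VB i] is - t_i. *)
Definition vtx := (nat + (nat * nat) + nat)%type.
Definition VA i : vtx := inl (inl i).
Definition VC i j : vtx := inl (inr (i, j)).
Definition VB i : vtx := inr i.

Definition wt (p : vtx) : vec :=
  match p with
  | inl (inl i) => xg - tv i
  | inl (inr (i, j)) => tv i + tv j - xg
  | inr i => - tv i
  end.

Definition wc (p : vtx) : crd :=
  match p with
  | inl (inl i) => subc xc (tc i)
  | inl (inr (i, j)) => subc (addc (tc i) (tc j)) xc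
  | inr i => scalec (-1) (tc i)
  end.

Definition pairs : seq (nat * nat) := [seq (i, j) | i <- iota 0 6, j <- iota i.+1 (5 - i)%N].
Definition verts : seq vtx :=
  [seq VA i | i <- iota 0 6] ++ [seq VC p.1 p.2 | p <- pairs] ++ [seq VB i | i <- iota 0 6].

Lemma evE (a : 'I_5) i : (i < 6)%N -> ev a 0 (inord i) = (i == a)%:R.
Proof. by move=> hi; rewrite mxE inordK //; case: eqP. Qed.

Lemma EEE i : (i < 6)%N -> EE 0 (inord i) = (i == 5%N)%:R.
Proof. by move=> hi; rewrite mxE inordK //; case: eqP. Qed.

Lemma SsumE i : (i < 6)%N -> Ssum 0 (inord i) = if i == 5%N then 0 else 1/2.
Proof.
move=> hi; rewrite mxE summxE !big_ord_recl big_ord0 !evE //.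
by case: i hi => [|[|[|[|[|[|]]]]]].
Qed.

Lemma halfsumE s i : (i < 6)%N ->
  halfsum s 0 (inord i) = if i == 5%N then 0 else sgn s (inord i) / 2.
Proof.
move=> hi; rewrite summxE; case: eqP => [->|/eqP i5].
  by rewrite big1 // => j _; rewrite mxE evE // gtn_eqF ?mulr0.
have hi5 : (i < 5)%N by rewrite ltn_neqAle i5.
rewrite (bigD1 (inord i)) //= big1 => [|j ji]; rewrite mxE evE //.
  by rewrite inordK // eqxx mulr1 addr0.
case: eqP => [ij|]; rewrite ?mulr0 //.
by case/eqP: ji; apply: val_inj; rewrite /= inordK.
Qed.

Lemma xgE : xg = vecc xc.
Proof.
apply: vec_eq => i hi; rewrite veccE // !mxE -/(Ssum 0 _).
by rewrite inordK // summxE !big_ord_recl big_ord0 !evE //;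
  case: i hi => [|[|[|[|[|[|]]]]]].
Qed.

Lemma tvE i : (i < 6)%N -> tv i = vecc (tc i).
Proof.
move=> hi; apply: vec_eq => n hn; rewrite veccE //.
case: i hi => [|k] hk; rewrite /tv /tc nth_mkseq //.
  by rewrite mxE SsumE // 2!mxE EEE //; case: n hn => [|[|[|[|[|[|]]]]]].
rewrite mxE evE // mxE EEE // inordK //.
case: n hn => [|[|[|[|[|[|]]]]]] // _; rewrite ?mulr0 ?addr0 //.
by rewrite gtn_eqF.
Qed.

Lemma all_iotaP (Q : nat -> bool) m i : all Q (iota 0 m) -> (i < m)%N -> Q i.
Proof. by move=> /allP H hi; apply: H; rewrite mem_iota. Qed.

Definition vtx_ok (p : vtx) :=
  match p with
  | inl (inl i) => i < 6
  | inl (inr (i, j)) => i < j < 6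
  | inr i => i < 6
  end%N.

Lemma verts_ok p : p \in verts -> vtx_ok p.
Proof. by have /allP H : all vtx_ok verts by []; exact: H. Qed.

Lemma vtx_okE p : (p \in verts) = vtx_ok p.
Proof.
apply/idP/idP; first exact: verts_ok.
case: p => [[i|[i j]]|i] /= h; [| have/andP[ij hj] := h; have hi := ltn_trans ij hj |].
- by case: i h => [|[|[|[|[|[|]]]]]].
- case: i hi ij {h} => [|[|[|[|[|[|i]]]]]] // _ ij;
    by case: j hj ij => [|[|[|[|[|[|j]]]]]].
- by case: i h => [|[|[|[|[|[|]]]]]].
Qed.

Lemma wtE p : p \in verts -> wt p = vecc (wc p).
Proof.
rewrite vtx_okE; case: p => [[i|[i j]]|i] /= h.
- by rewrite vecc_sub xgE tvE.
- case/andP: h => ij h; have hi := ltn_trans ij h.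
  by rewrite vecc_sub vecc_add xgE !tvE.
- by rewrite vecc_scale scaleN1r tvE.
Qed.

(** The half-integral weights sorted by their number of minus signs, namely 1, 3 and 5. The
    successor appears because ['I_5] counts from 0 while the t_i matching the e_i start at 1. *)
Definition sgA (i : nat) : signs := [ffun k : 'I_5 => k.+1 != i].
Definition sgC (i j : nat) : signs := [ffun k : 'I_5 => (k.+1 == i) || (k.+1 == j)].
Definition sgB : signs := [ffun=> false].

Lemma signs_nth (s : signs) :
  s = [ffun k : 'I_5 => nth true [seq s (inord n) | n <- iota 0 5] k].
Proof.
apply/ffunP => k; rewrite ffunE (nth_map 0%N) ?size_iota // nth_iota //.
by rewrite add0n inord_val.
Qed.

Lemma card_negs (b : seq bool) :
  #|negs [ffun k : 'I_5 => nth true b k]| = sumn [seq (~~ nth true b n : nat) | n <- iota 0 5].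
Proof.
rewrite -sum1_card big_mkcond /= !big_ord_recl big_ord0 !inE !ffunE /= /bump /=.
by do 5![case: (nth _ _ _)].
Qed.

Lemma signs_ext (s s' : signs) :
  (forall k, (k < 5)%N -> s (inord k) = s' (inord k)) -> s = s'.
Proof. by move=> H; apply/ffunP => k; have := H k (ltn_ord k); rewrite inord_val. Qed.

Lemma odd_signs (s : signs) : odd #|negs s| ->
  [\/ exists2 i, (0 < i < 6)%N & s = sgA i,
      exists i j, [/\ (0 < i < j)%N, (j < 6)%N & s = sgC i j] | s = sgB].
Proof.
rewrite (signs_nth s) card_negs /=.
set b := [:: _; _; _; _; _].
have sb (s' : signs) : (forall k : 'I_5, s' k = nth true b k) ->
    [ffun k : 'I_5 => nth true b k] = s'.
  by move=> H; apply/ffunP => k; rewrite ffunE H.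
rewrite {}/b in sb *.
move: (s (inord 0)) (s (inord 1)) (s (inord 2)) (s (inord 3)) (s (inord 4)) sb.
case; case; case; case; case=> // sb _.
all: first
 [ by apply: Or33; apply: sb => -[[|[|[|[|[|k]]]]] hk]; rewrite ?ffunE
 | by apply: Or31; exists 1%N => //; apply: sb => -[[|[|[|[|[|k]]]]] hk]; rewrite ?ffunE
 | by apply: Or31; exists 2%N => //; apply: sb => -[[|[|[|[|[|k]]]]] hk]; rewrite ?ffunE
 | by apply: Or31; exists 3%N => //; apply: sb => -[[|[|[|[|[|k]]]]] hk]; rewrite ?ffunE
 | by apply: Or31; exists 4%N => //; apply: sb => -[[|[|[|[|[|k]]]]] hk]; rewrite ?ffunE
 | by apply: Or31; exists 5%N => //; apply: sb => -[[|[|[|[|[|k]]]]] hk]; rewrite ?ffunE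
 | idtac ].
all: apply: Or32.
Ltac tryC i j sb := exists i, j; split => //;
  apply: sb => -[[|[|[|[|[|k]]]]] hk]; by rewrite ?ffunE.
all: first [ tryC 1%N 2%N sb | tryC 1%N 3%N sb | tryC 1%N 4%N sb | tryC 1%N 5%N sb
  | tryC 2%N 3%N sb | tryC 2%N 4%N sb | tryC 2%N 5%N sb | tryC 3%N 4%N sb
  | tryC 3%N 5%N sb | tryC 4%N 5%N sb ].
Qed.

Definition signc (s : seq bool) (c : rat) : crd :=
  rcons [seq (if nth true s n then 1/2 else - (1/2)) | n <- iota 0 5] c.

Lemma halfsum_code (b : seq bool) c :
  halfsum [ffun k : 'I_5 => nth true b k] + c *: EE = vecc (signc b c).
Proof.
apply: vec_eq => i hi; rewrite veccE // mxE halfsumE // mxE EEE //.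
case: eqP => [->|/eqP i5]; first by rewrite add0r mulr1.
have hi5 : (i < 5)%N by rewrite ltn_neqAle i5.
rewrite mulr0 addr0 /signc nth_rcons size_map size_iota hi5.
rewrite (nth_map 0%N) ?size_iota // nth_iota // add0n /sgn ffunE inordK //.
by case: ifP => _; rewrite ?mulN1r ?mul1r ?div1r.
Qed.

Definition bool_seqs (n : nat) : seq (seq bool) :=
  iter n (fun l => [seq true :: b | b <- l] ++ [seq false :: b | b <- l]) [:: [::]].

Lemma mem_bool_seqs b : b \in bool_seqs (size b).
Proof.
elim: b => [|[] b IHb] //=; rewrite mem_cat; apply/orP; [left | right].
  exact: (map_f (cons true)).
exact: (map_f (cons false)).
Qed.

Lemma signs_all (Q : seq bool -> bool) (s : signs) :
  all Q (bool_seqs 5) -> Q [seq s (inord n) | n <- iota 0 5].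
Proof. by move=> /allP H; apply/H/(mem_bool_seqs [seq s (inord n) | n <- iota 0 5]). Qed.

Lemma wt_half_code p b : p \in verts -> wc p == signc b (1/6) ->
  wt p = halfsum [ffun k : 'I_5 => nth true b k] + (1/6) *: EE.
Proof. by move=> hp /eqP e; rewrite halfsum_code -e wtE. Qed.

Lemma pm_code (a b : 'I_5) (c d e : rat) :
  c *: ev a + d *: ev b + e *: EE =
  vecc (mkseq (fun n => c * (n == a)%:R + d * (n == b)%:R + e * (n == 5%N)%:R) 6).
Proof.
by apply: vec_eq => i hi; rewrite veccE // 2!vD 3!vZ !evE // EEE // nth_mkseq.
Qed.

Lemma all_iota2P (Q : nat -> nat -> bool) m n i j :
  all (fun i => all (Q i) (iota 0 n)) (iota 0 m) -> (i < m)%N -> (j < n)%N -> Q i j.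
Proof. by move=> H hi hj; apply: (all_iotaP (all_iotaP H hi) hj). Qed.

Lemma tbar_wt : tbar = wt (VA 0).
Proof.
rewrite wtE //; apply: vec_eq => i hi; rewrite veccE // mxE EEE //.
by case: i hi => [|[|[|[|[|[|]]]]]].
Qed.

Lemma wt_pos (j : 'I_5) : ev j - (1/3) *: EE = wt (VC 0 j.+1).
Proof.
have := pm_code j j 1 0 (-(1/3)); rewrite scale0r addr0 scale1r scaleNr => ->.
have hj : (j.+1 < 6)%N := ltn_ord j.
rewrite wtE ?vtx_okE //; congr vecc; apply/eqP.
by case: j {hj} => [[|[|[|[|[|]]]]]].
Qed.

Lemma wt_neg (j : 'I_5) : - ev j - (1/3) *: EE = wt (VB j.+1).
Proof.
have := pm_code j j (-1) 0 (-(1/3)); rewrite scale0r addr0 scaleN1r scaleNr => ->.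
have hj : (j.+1 < 6)%N := ltn_ord j.
rewrite wtE ?vtx_okE //; congr vecc; apply/eqP.
by case: j {hj} => [[|[|[|[|[|]]]]]].
Qed.

Lemma halfsum_eq_wt (s : signs) p : p \in verts ->
  wc p == signc [seq s (inord n) | n <- iota 0 5] (1/6) ->
  halfsum s + (1/6) *: EE = wt p.
Proof. by move=> hp e; rewrite (wt_half_code hp e) -signs_nth. Qed.

Lemma wt_sgA i : (0 < i < 6)%N -> halfsum (sgA i) + (1/6) *: EE = wt (VA i).
Proof.
case/andP => i0 i6; apply: halfsum_eq_wt; first by rewrite vtx_okE.
rewrite /= !ffunE !inordK //.
by case: i i0 i6 => [|[|[|[|[|[|]]]]]].
Qed.

Lemma wt_sgC i j : (0 < i < j)%N -> (j < 6)%N -> halfsum (sgC i j) + (1/6) *: EE = wt (VC i j).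
Proof.
case/andP => i0 ij j6; apply: halfsum_eq_wt; first by rewrite vtx_okE /= ij.
rewrite /= !ffunE !inordK //.
by case: j j6 ij => [|[|[|[|[|[|]]]]]] // _; case: i i0 => [|[|[|[|[|[|]]]]]].
Qed.

Lemma wt_sgB : halfsum sgB + (1/6) *: EE = wt (VB 0).
Proof. by apply: halfsum_eq_wt; rewrite //= !ffunE. Qed.

Lemma inLambda_wt v : inLambda v -> exists2 p, p \in verts & v = wt p.
Proof.
case/or3P => [/eqP-> | /existsP[s /andP[os /eqP->]] | /existsP[j /orP[] /eqP->]].
- by exists (VA 0) => //; rewrite tbar_wt.
- case: (odd_signs os) => [[i hi ->]|[i [j [/andP[i0 ij] j6 ->]]]|->].
  + by exists (VA i); [rewrite vtx_okE; case/andP: hi | rewrite wt_sgA].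
  + exists (VC i j); last by rewrite wt_sgC ?i0.
    by rewrite vtx_okE /= ij.
  + by exists (VB 0); last by rewrite wt_sgB.
- by exists (VC 0 j.+1); rewrite ?wt_pos // vtx_okE; exact: (ltn_ord j).
- by exists (VB j.+1); rewrite ?wt_neg // vtx_okE; exact: (ltn_ord j).
Qed.

Lemma odd_sgA i : (0 < i < 6)%N -> odd #|negs (sgA i)|.
Proof.
case/andP => i0 i6; rewrite (signs_nth (sgA i)) card_negs /= !ffunE !inordK //.
by case: i i0 i6 => [|[|[|[|[|[|]]]]]].
Qed.

Lemma card_sgC i j : (0 < i < j)%N -> (j < 6)%N -> #|negs (sgC i j)| = 3%N.
Proof.
case/andP => i0 ij j6; rewrite (signs_nth (sgC i j)) card_negs /= !ffunE !inordK //.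
by case: j j6 ij => [|[|[|[|[|[|]]]]]] // _; case: i i0 => [|[|[|[|[|[|]]]]]].
Qed.

Lemma card_sgA i : (0 < i < 6)%N -> #|negs (sgA i)| = 1%N.
Proof.
case/andP => i0 i6; rewrite (signs_nth (sgA i)) card_negs /= !ffunE !inordK //.
by case: i i0 i6 => [|[|[|[|[|[|]]]]]].
Qed.

Lemma card_sgB : #|negs sgB| = 5%N.
Proof. by rewrite (signs_nth sgB) card_negs /= !ffunE. Qed.

Lemma wt_inLambda p : p \in verts -> inLambda (wt p).
Proof.
have half (s : signs) p' : odd #|negs s| -> halfsum s + (1/6) *: EE = wt p' -> inLambda (wt p').
  move=> os e; apply/or3P/Or32/existsP; exists s; rewrite os /=; exact/eqP.
have ordS k : (0 < k < 6)%N -> exists j : 'I_5, k = j.+1.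
  by case: k => // k hk; exists (Ordinal (hk : (k < 5)%N)).
rewrite vtx_okE; case: p => [[i|[i j]]|i] /= h.
- case: (posnP i) => [->|i0]; first by apply/or3P/Or31; rewrite tbar_wt.
  by apply: (half (sgA i) (VA i)); rewrite ?wt_sgA ?odd_sgA ?i0.
- case/andP: h => ij j6; case: (posnP i) => [i0|i0].
    have [|k ->] := ordS j; first by rewrite j6 -i0 (leq_ltn_trans _ ij).
    rewrite i0; change (inLambda (wt (VC 0 k.+1))); rewrite -wt_pos.
    by apply/or3P/Or33/existsP; exists k; rewrite eqxx.
  by apply: (half (sgC i j) (VC i j)); rewrite ?wt_sgC ?card_sgC ?i0.
- case: (posnP i) => [->|i0].
    by apply: (half sgB (VB 0)); rewrite ?wt_sgB ?card_sgB.
  have [|k ->] := ordS i; first by rewrite i0.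
  change (inLambda (wt (VB k.+1))); rewrite -wt_neg; apply/or3P/Or33/existsP; exists k.
  by rewrite eqxx orbT.
Qed.

(** * The roots in terms of t_0, ..., t_5 and x *)

Definition triples : seq (nat * nat * nat) :=
  [seq (p, k) | p <- pairs, k <- iota p.2.+1 (5 - p.2)%N].
(** The 15 + 20 + 1 positive roots as seen from the subsystem A_5 x A_1: the t_j - t_i span A_5, and
    x, which is orthogonal to them, spans A_1. *)
Definition rootL : seq crd :=
  [seq subc (tc p.2) (tc p.1) | p <- pairs]
  ++ [seq subc (addc (addc (tc q.1.1) (tc q.1.2)) (tc q.2)) xc | q <- triples] ++ [:: xc].

Lemma posRoot_code a : posRoot a -> exists2 r, r \in rootL & a = vecc r.
Proof.
have two (i j : 'I_5) (Q : nat -> nat -> bool) :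
    all (fun m => all (Q m) (iota 0 5)) (iota 0 5) -> Q i j.
  by move=> H; apply: (all_iota2P H).
case/orP => [/existsP[i /existsP[j /andP[ij /orP[] /eqP->]]] | /existsP[s /andP[os /eqP->]]].
- have := pm_code j i 1 1 0; rewrite !scale1r scale0r addr0 => ->.
  eexists; last by [].
  move: ij; apply/implyP.
  pose Q m n := (m < n)%N ==>
    (mkseq (fun k => 1 * (k == n)%:R + 1 * (k == m)%:R + 0 * (k == 5%N)%:R) 6 \in rootL).
  by apply: (two i j Q); vm_compute.
- have := pm_code j i 1 (-1) 0; rewrite scaleN1r scale1r scale0r addr0 => ->.
  eexists; last by [].
  move: ij; apply/implyP.
  pose Q m n := (m < n)%N ==>
    (mkseq (fun k => 1 * (k == n)%:R + (-1) * (k == m)%:R + 0 * (k == 5%N)%:R) 6 \in rootL).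
  by apply: (two i j Q); vm_compute.
- move: os; rewrite (signs_nth s) card_negs halfsum_code => os.
  eexists; last by [].
  pose Q b := ~~ odd (sumn [seq (~~ nth true b n : nat) | n <- iota 0 5]) ==>
    (signc b (1/2) \in rootL).
  by apply: (implyP (@signs_all Q s _) os); vm_compute.
Qed.

Lemma rootL_posRoot r : r \in rootL -> posRoot (vecc r).
Proof.
move=> hr; apply/orP.
pose P1 (i j : nat) := (i < j)%N &&
  ((r == mkseq (fun k => 1 * (k == j)%:R + 1 * (k == i)%:R + 0 * (k == 5%N)%:R) 6)
   || (r == mkseq (fun k => 1 * (k == j)%:R + (-1) * (k == i)%:R + 0 * (k == 5%N)%:R) 6)).
pose P2 b := ~~ odd (sumn [seq (~~ nth true b n : nat) | n <- iota 0 5]) && (r == signc b (1/2)).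
have : has (fun i => has (P1 i) (iota 0 5)) (iota 0 5) || has P2 (bool_seqs 5).
  rewrite {}/P1 {}/P2; move: r hr; apply/allP; vm_compute.
  by [].
case/orP => [/hasP[i hi /hasP[j hj]] | /hasP[b _ /andP[eb /eqP->]]]; last first.
  right; apply/existsP; exists [ffun k : 'I_5 => nth true b k].
  by rewrite card_negs eb halfsum_code eqxx.
rewrite !mem_iota !add0n in hi hj.
case/andP => ij hr2; left; apply/existsP; exists (Ordinal hi).
apply/existsP; exists (Ordinal hj); rewrite /= ij /=.
case/orP: hr2 => /eqP ->; apply/orP; [left | right].
  by rewrite -(pm_code (Ordinal hj) (Ordinal hi)) !scale1r scale0r addr0.
by rewrite -(pm_code (Ordinal hj) (Ordinal hi)) scaleN1r !scale1r scale0r addr0.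
Qed.

(** * The ring H^*(BT) *)

Lemma HBT_0 : HBT 0.
Proof. by rewrite -(subrr 1); apply: HBT_add; [|apply: HBT_opp]; apply: HBT_1. Qed.

Lemma HBT_sub p q : HBT p -> HBT q -> HBT (p - q).
Proof. by move=> hp hq; apply: HBT_add => //; apply: HBT_opp. Qed.

Lemma HBT_nat n : HBT n%:R.
Proof.
elim: n => [|n IHn]; first exact: HBT_0.
by rewrite mulrS; apply: HBT_add => //; apply: HBT_1.
Qed.

Lemma HBT_int (z : int) : HBT z%:~R.
Proof. by case: z => n; [|apply: HBT_opp]; apply: HBT_nat. Qed.

Lemma HBT_exp p n : HBT p -> HBT (p ^+ n).
Proof.
move=> hp; elim: n => [|n IHn]; first by rewrite expr0; apply: HBT_1.
by rewrite exprS; apply: HBT_mul.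
Qed.

Lemma HBT_prod (I : eqType) (s : seq I) (F : I -> P) :
  (forall i, i \in s -> HBT (F i)) -> HBT (\prod_(i <- s) F i).
Proof.
move=> H; rewrite big_seq; apply: big_ind => //; first exact: HBT_1.
exact: HBT_mul.
Qed.

Definition T (i : nat) : P := lin (tv i).
Definition X : P := lin xg.

Lemma HBT_X : HBT X.
Proof. by apply: HBT_gen; do 2!right. Qed.

Lemma HBT_T i : HBT (T i).
Proof. by apply: HBT_gen; case: i => [|i]; [left | right; left; exists (inord i)]. Qed.

Lemma lin_wtA i : lin (wt (VA i)) = X - T i.
Proof. by rewrite linB. Qed.

Lemma lin_wtC i j : lin (wt (VC i j)) = T i + T j - X.
Proof. by rewrite linB linD. Qed.

Lemma lin_wtB i : lin (wt (VB i)) = - T i.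
Proof. by rewrite linN. Qed.

Lemma lin_tc i : (i < 6)%N -> lin (vecc (tc i)) = T i.
Proof. by move=> hi; rewrite -tvE. Qed.

Lemma HBT_lin_wt p : HBT (lin (wt p)).
Proof.
case: p => [[i|[i j]]|i].
- by rewrite lin_wtA; apply: HBT_sub; [apply: HBT_X | apply: HBT_T].
- by rewrite lin_wtC; apply: HBT_sub; [apply: HBT_add; apply: HBT_T | apply: HBT_X].
- by rewrite lin_wtB; apply/HBT_opp/HBT_T.
Qed.

Definition e6roots : seq crd := rootL ++ [seq scalec (-1) b | b <- rootL].

Lemma pairs_lt p : p \in pairs -> (p.1 < p.2 < 6)%N.
Proof. by have /allP H : all (fun p => p.1 < p.2 < 6)%N pairs by []; exact: H. Qed.

Lemma HBT_rootL b : b \in rootL -> HBT (lin (vecc b)).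
Proof.
rewrite !mem_cat => /or3P[/mapP[p hp ->] | /mapP[q hq ->] | ].
- have /andP[ij hj] := pairs_lt hp.
  rewrite vecc_sub linB !lin_tc ?(ltn_trans ij) //.
  by apply: HBT_sub; apply: HBT_T.
- have /allP /(_ _ hq) : all (fun q => (q.1.1 < 6) && (q.1.2 < 6) && (q.2 < 6))%N triples by [].
  case/andP => /andP[h1 h2] h3.
  rewrite vecc_sub linB -xgE -/X !vecc_add !linD !lin_tc //.
  by apply: HBT_sub HBT_X; do 2?[apply: HBT_add]; apply: HBT_T.
- by rewrite inE => /eqP ->; rewrite -xgE; apply: HBT_X.
Qed.

Lemma lin_vecc_opp b : lin (vecc (scalec (-1) b)) = - lin (vecc b).
Proof. by rewrite vecc_scale scaleN1r linN. Qed.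

Lemma HBT_root b : b \in e6roots -> HBT (lin (vecc b)).
Proof.
rewrite mem_cat => /orP[/HBT_rootL // | /mapP[c /HBT_rootL hc ->]].
by rewrite lin_vecc_opp; apply: HBT_opp.
Qed.

(** * Divisibility by roots in H^*(BT) *)

Definition coprimec (a b : crd) := (dotc a b) ^+ 2 != 4.

Section Projection.
Variables (b beta : crd).
Hypothesis dot_b_beta : dotc b beta = 1.

(** Projection along [b] onto the hyperplane orthogonal to [beta]. Its extension [phi] to
    polynomials models reduction modulo [b] inside the same ring, so that divisibility by [b] turns
    into vanishing. *)
Definition projb (v : vec) : vec := v - dot v (vecc beta) *: vecc b.
Definition subst_lin : 6.-tuple P := [tuple lin (projb (delta_mx 0 k)) | k < 6].
Definition phi (p : P) : P := p \mPo subst_lin.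

Lemma phiM p q : phi (p * q) = phi p * phi q.
Proof. exact: rmorphM. Qed.

Lemma phi_lin v : phi (lin v) = lin (projb v).
Proof.
have e : v = \sum_k v 0 k *: delta_mx 0 k by rewrite {1}[v]row_sum_delta.
have lin_sum (F : 'I_6 -> vec) : lin (\sum_k F k) = \sum_k lin (F k).
  apply: (big_morph _ linD); rewrite -(scale0r 0) linZ; exact: scale0r.
have -> : projb v = \sum_k v 0 k *: projb (delta_mx 0 k).
  have -> : \sum_k v 0 k *: projb (delta_mx 0 k) =
     \sum_k v 0 k *: delta_mx 0 k - (\sum_k v 0 k * dot (delta_mx 0 k) (vecc beta)) *: vecc b.
    rewrite scaler_suml -sumrB; apply: eq_bigr => k _.
    by rewrite scalerBr scalerA.
  rewrite -e; congr (_ - _ *: _); rewrite {1}e.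
  rewrite (big_morph (fun u => dot u (vecc beta)) (id1 := 0) (op1 := +%R)).
  - by apply: eq_bigr => k _; rewrite dotZl.
  - by move=> u w; rewrite dotDl.
  - exact: dot0l.
rewrite lin_sum /phi /lin linear_sum; apply: eq_bigr => k _ /=.
rewrite comp_mpolyZ comp_mpolyXU -tnth_nth tnth_mktuple.
exact/esym/linZ.
Qed.

Lemma phi_b : phi (lin (vecc b)) = 0.
Proof. by rewrite phi_lin /projb dotcE dot_b_beta scale1r subrr -(scale0r 0) linZ scale0r. Qed.

(** If the projection kills [a], then a = c b; equal norms force c^2 = 1, so the inner product of
    [a] and [b] squares to 4. *)
Lemma phi_coprime a : dotc a a = 2 -> dotc b b = 2 -> coprimec a b ->
  phi (lin (vecc a)) != 0.
Proof.
move=> aa bb /eqP ab; apply/eqP; rewrite phi_lin => /lin_eq0 /eqP.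
rewrite subr_eq0; set c := dot _ _ => /eqP e.
have ab2 : dotc a b = 2 * c by rewrite -dotcE e dotZl dotcE bb mulrC.
have : 2 = c * (2 * c) by rewrite -{1}aa -ab2 -!dotcE {1}e dotZl dotC.
by move=> h; apply: ab; rewrite ab2; lra.
Qed.

Hypothesis HBT_b : HBT (lin (vecc b)).
Hypothesis beta_int : forall v, lattice_gen v ->
  exists z : int, dot v (vecc beta) = z%:~R.

(** On a lattice generator the quotient is the integer by which [beta] pairs with it, and the ring
    operations preserve the congruence. This is where divisibility is obtained over the integers
    rather than over the rationals. *)
Lemma phi_cong p : HBT p -> exists g, HBT g /\ p - phi p = lin (vecc b) * g.
Proof.
elim=> {p} [v /beta_int[z ez]||p q hp [g [hg eg]] hq [h [hh eh]]
           |p hp [g [hg eg]]|p q hp [g [hg eg]] hq [h [hh eh]]].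
- exists z%:~R; split; first exact: HBT_int.
  by rewrite phi_lin linB opprB addrC subrK linZ ez scaler_int mulrzr.
- exists 0; split; first exact: HBT_0.
  by rewrite /phi comp_mpoly1 subrr mulr0.
- exists (g + h); split; first exact: HBT_add.
  by rewrite mulrDr -eg -eh /phi comp_mpolyD opprD addrACA.
- exists (- g); split; first exact: HBT_opp.
  by rewrite mulrN -eg /phi comp_mpolyN opprD.
- exists (g * q + (p - lin (vecc b) * g) * h); split.
    by apply: HBT_add; apply: HBT_mul => //; apply: HBT_sub => //; apply: HBT_mul.
  rewrite mulrDr mulrA -eg mulrCA -eh opprB addrCA subrr addr0 phiM.
  by rewrite mulrBl mulrBr addrA subrK.
Qed.
End Projection.

Lemma root_sq b : b \in e6roots -> dotc b b = 2.
Proof.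
have /allP H : all (fun b => dotc b b == 2) e6roots by vm_compute.
by move=> /H /eqP.
Qed.

(** Choosing the dual vector among the roots makes its pairing with H^2(BT) integral, by
    [root_integral]. *)
Lemma root_dual b : b \in e6roots -> exists2 beta, beta \in e6roots & dotc b beta = 1.
Proof.
move=> hb; suff /hasP[beta hbeta /eqP] : has (fun c => dotc b c == 1) e6roots by exists beta.
by move: b hb; apply/allP; vm_compute.
Qed.

Lemma root_integral b v : b \in e6roots -> lattice_gen v ->
  exists z : int, dot v (vecc b) = z%:~R.
Proof.
move=> hb hv; have [k hk ->] : exists2 c, c \in xc :: [seq tc i | i <- iota 0 6] & v = vecc c.
  case: hv => [->|[[i ->]| ->]].
  - by exists (tc 0) => //; rewrite -tvE.
  - exists (tc i.+1).
      by rewrite inE; apply/orP; right; apply: map_f; rewrite mem_iota; exact: (ltn_ord i).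
    by rewrite -tvE /tv ?inord_val //; exact: (ltn_ord i).
  - by exists xc; rewrite ?mem_head // xgE.
rewrite dotcE.
suff /hasP[z _ /eqP ->] : has (fun z : int => dotc k b == z%:~R) [:: - 2; - 1; 0; 1; 2].
  by exists z.
move: b hb k hk; pose Q b k := has (fun z : int => dotc k b == z%:~R) [:: - 2; - 1; 0; 1; 2].
suff H : all (fun b => all (Q b) (xc :: [seq tc i | i <- iota 0 6])) e6roots.
  by move=> b hb k hk; apply: (allP (allP H b hb) k hk).
by vm_compute.
Qed.

(** Apply [phi]: the right side dies and no factor on the left does, so [phi] kills [g] because
    polynomials form a domain; then [phi_cong] divides [g] by [b] in H^*(BT). *)
Lemma root_gauss b (s : seq crd) g h : b \in e6roots -> {subset s <= e6roots} ->
  all (coprimec^~ b) s -> HBT g ->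
  (\prod_(a <- s) lin (vecc a)) * g = lin (vecc b) * h ->
  exists g', HBT g' /\ g = lin (vecc b) * g'.
Proof.
move=> hb sR scop hg e.
have [beta hbeta bb] := root_dual hb.
have phig : phi b beta g = 0.
  have : phi b beta (\prod_(a <- s) lin (vecc a)) * phi b beta g = 0.
    by rewrite -phiM e phiM phi_b // mul0r.
  move/eqP; rewrite mulf_eq0 => /orP[|/eqP //].
  rewrite /phi rmorph_prod prodf_seq_eq0 => /hasP[a ha /=] /eqP a0.
  have := @phi_coprime b beta a (root_sq (sR _ ha)) (root_sq hb) (allP scop _ ha).
  by rewrite /phi a0 eqxx.
have [g' [hg' e']] := phi_cong (HBT_root hb) (fun v => root_integral hbeta) hg.
by exists g'; split=> //; rewrite -e' phig subr0.
Qed.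

Lemma root_prod_dvd (s : seq crd) F : {subset s <= e6roots} -> HBT F ->
  pairwise coprimec s ->
  (forall a, a \in s -> exists g, HBT g /\ F = lin (vecc a) * g) ->
  exists g, HBT g /\ F = (\prod_(a <- s) lin (vecc a)) * g.
Proof.
move=> sR hF; elim/last_ind: s sR => [|s b IHs] sR.
  by exists F; rewrite big_nil mul1r.
rewrite pairwise_rcons => /andP[cb cs] H.
have [a ha||| g [hg e]] := IHs; first by apply: sR; rewrite mem_rcons inE ha orbT.
- by [].
- by move=> a ha; apply: H; rewrite mem_rcons inE ha orbT.
have hb : b \in rcons s b by rewrite mem_rcons mem_head.
have [h [_ eh]] := H b hb.
have [||||g' [hg' eg]] := @root_gauss b s g h _ _ _ hg; rewrite -?e -?eh //.
- exact: sR.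
- by move=> a ha; apply: sR; rewrite mem_rcons inE ha orbT.
by exists g'; split => //; rewrite big_rcons /= e eg; ring.
Qed.

(** * GKM functions *)

(** The weights are minuscule: each pairs with a root to 0, 1 or -1, so a reflection that moves a
    vertex shifts it by exactly one root, up to sign the label. *)
Lemma edge_root u v a : edge u v a -> exists p q r,
  [/\ p \in verts, q \in verts & r \in e6roots] /\
  [/\ u = wt p, v = wt q, u - v = vecc r & lin (vecc r) = lin a \/ lin (vecc r) = - lin a].
Proof.
case/and5P => /inLambda_wt[p hp ->] /inLambda_wt[q hq ->] npq /posRoot_code[r hr ->] /eqP.
have hr' : r \in e6roots by rewrite mem_cat hr.
have dp : dot (wt p) (vecc r) = dotc (wc p) r by rewrite wtE // dotcE.
rewrite /refl dp dotcE (root_sq hr').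
have -> c : 2 * c / 2 = c :> rat by field.
have /or3P : [|| dotc (wc p) r == 0, dotc (wc p) r == 1 | dotc (wc p) r == -1].
  move: p hp r hr {q hq npq hr' dp}.
  pose Q p r := [|| dotc (wc p) r == 0, dotc (wc p) r == 1 | dotc (wc p) r == -1].
  suff H : all (fun p => all (Q p) rootL) verts.
    by move=> p hp r hr; apply: (allP (allP H p hp) r hr).
  by vm_compute.
case=> /eqP ->.
- by rewrite scale0r subr0 => e; rewrite e eqxx in npq.
- rewrite scale1r => e; exists p, q, r; split=> //; split=> //; last by left.
  by rewrite -e opprB addrC subrK.
- rewrite scaleN1r opprK => e; exists p, q, (scalec (-1) r); split; first split=> //.
    by rewrite mem_cat map_f ?orbT.
  split=> //; first by rewrite -e opprD addrA subrr add0r vecc_scale scaleN1r.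
  by right; rewrite lin_vecc_opp.
Qed.

(** * Elementary symmetric functions of a sequence *)

(** On explicit lists this recursion simplifies to polynomials that [ring] can treat, unlike the sum
    over subsets; its symmetry is read off the generating product in [coef_prod_es]. *)
Fixpoint es {R : comNzRingType} (k : nat) (s : seq R) : R :=
  match k, s with
  | 0, _ => 1
  | _.+1, [::] => 0
  | k'.+1, x :: s' => es k s' + x * es k' s'
  end.

Lemma coef_prod_es (R : comNzRingType) (s : seq R) k :
  (\prod_(x <- s) (1 + x%:P * 'X))`_k = es k s.
Proof.
elim: s k => [|x s IHs] [|k]; rewrite ?big_nil ?big_cons ?coef1 //=.
  by rewrite mulrDl mul1r coefD IHs -mulrA coefCM coefXM mulr0 addr0; case: (s).
by rewrite mulrDl mul1r coefD IHs -mulrA coefCM coefXM IHs.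
Qed.

Lemma es_perm (R : comNzRingType) (s s' : seq R) k : perm_eq s s' -> es k s = es k s'.
Proof. by move=> e; rewrite -!coef_prod_es (perm_big _ e). Qed.

Lemma esym_es k : Defs.esym k = es k [seq lin (ev i) | i <- index_enum 'I_5].
Proof.
rewrite -coef_prod_es big_map /=.
under eq_bigr do rewrite addrC.
rewrite bigA_distr coef_sum /Defs.esym [LHS]big_mkcond /=.
apply: eq_big => [J|J _]; first by rewrite inE.
have -> : \prod_(i : 'I_5) (if i \in J then (lin (ev i))%:P * 'X else 1) =
          (\prod_(i in J) lin (ev i))%:P * 'X^#|J| :> {poly P}.
  rewrite -big_mkcond big_split /= -prodr_const; congr (_ * _).
  by rewrite rmorph_prod.
by rewrite coefCM coefXn eq_sym; case: eqP => _; rewrite ?mulr1 ?mulr0.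
Qed.

(** * The values of omega *)

Definition rest2 (i j : nat) : seq nat := [seq n <- iota 0 6 | (n != i) && (n != j)].
Definition ct (k : nat) : P := es k [seq T i | i <- iota 0 6].

(** The values of omega in a form symmetric under all permutations of the six indices, whereas the
    defining formulas single out index 0 and, at -e_j - E/3, an auxiliary index k. *)
Definition omv (p : vtx) : P :=
  match p with
  | inl (inl i) => 0
  | inl (inr (i, j)) => \prod_(n <- rest2 i j) (2 * X - T i - T j - T n)
  | inr i => X * (2 * T i ^+ 3 - 3 * T i * X ^+ 2 - 5 * X ^+ 3 + (2 * X + T i) * ct 2 - ct 3)
  end.

Lemma omega_half (s : signs) : odd #|negs s| ->
  omega (halfsum s + (1/6) *: EE) = omega_odd s (halfsum s + (1/6) *: EE).
Proof.
(* The coefficient of E separates the cases: 2/3 for [tbar], 1/6 for the half sums, -1/3 for the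
   remaining weights. *)
move=> os; rewrite /omega ifF; last first.
  apply/eqP => /(congr1 (fun v : vec => v 0 (inord 5))).
  by rewrite vD vZ halfsumE // EEE // vZ EEE.
case: pickP => [s' /andP[_ /eqP e]|/(_ s)]; last by rewrite os eqxx.
congr (omega_odd _ _); apply: signs_ext => k k5.
have k6 : (k < 6)%N by apply: (ltn_trans k5).
move: e => /(congr1 (fun v : vec => v 0 (inord k))).
rewrite !vD !halfsumE // ltn_eqF // => /addIr.
by rewrite /sgn; case: (s _); case: (s' _).
Qed.

Lemma omega_posE (j : 'I_5) : omega (ev j - (1/3) *: EE) = omega_pos j (ev j - (1/3) *: EE).
Proof.
rewrite /omega ifF; last first.
  apply/eqP => /(congr1 (fun v : vec => v 0 (inord 5))).
  rewrite vD evE // -scaleNr !vZ !EEE // gtn_eqF //; exact: (ltn_trans (ltn_ord j)).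
case: pickP => [s /andP[_ /eqP /(congr1 (fun v : vec => v 0 (inord 5)))]|_].
  by rewrite !vD evE // -scaleNr !vZ !EEE // gtn_eqF // halfsumE.
case: pickP => [j' /eqP /addIr e|/(_ j)]; last by rewrite eqxx.
congr (omega_pos _ _).
have j6 : (j < 6)%N by apply: (ltn_trans (ltn_ord j)).
move: e => /(congr1 (fun v : vec => v 0 (inord j))); rewrite !evE // eqxx.
by case: eqP => // e _; apply: val_inj.
Qed.

Lemma omega_negE (j : 'I_5) : omega (- ev j - (1/3) *: EE) = omega_neg j (- ev j - (1/3) *: EE).
Proof.
have j6 : (j < 6)%N by apply: (ltn_trans (ltn_ord j)).
rewrite /omega ifF; last first.
  apply/eqP => /(congr1 (fun v : vec => v 0 (inord 5))).
  by rewrite vD -!scaleN1r !vZ evE // !EEE // gtn_eqF.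
case: pickP => [s /andP[_ /eqP /(congr1 (fun v : vec => v 0 (inord 5)))]|_].
  by rewrite !vD -!scaleN1r !vZ evE // !EEE // gtn_eqF // halfsumE.
case: pickP => [j' /eqP /addIr /(congr1 (fun v : vec => v 0 (inord j)))|_].
  by rewrite -scaleN1r vZ !evE // eqxx; case: eqP.
case: pickP => [j' /eqP /addIr /oppr_inj e|/(_ j)]; last by rewrite eqxx.
congr (omega_neg _ _).
move: e => /(congr1 (fun v : vec => v 0 (inord j))); rewrite !evE // eqxx.
by case: eqP => // e _; apply: val_inj.
Qed.

Lemma sum_T : \sum_(i < 6) T i = 3 * X.
Proof.
have -> : 3 * X = lin (3 *: xg) by rewrite linZ mulr_natl scaler_nat.
rewrite -[LHS](big_morph lin linD (id1 := 0) (id2 := 0)); last first.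
  by rewrite -(scale0r 0) linZ scale0r.
congr lin; rewrite xgE -vecc_scale.
transitivity (vecc (addc (tc 0) (addc (tc 1) (addc (tc 2) (addc (tc 3) (addc (tc 4) (tc 5))))))).
  by rewrite !big_ord_recl big_ord0 addr0 !vecc_add -!tvE.
by congr vecc; apply/eqP; vm_compute.
Qed.

Lemma T0E : T 0 = 3 * X - T 1 - T 2 - T 3 - T 4 - T 5.
Proof. by rewrite -sum_T !big_ord_recl big_ord0 /= /bump /=; ring. Qed.

(** With E/6 as an atom, x - t_0 and the e_i become integral combinations of the t_i and E/6, so the
    identities hold over any commutative ring. *)
Definition Ebar : P := lin ((1/6) *: EE).

Lemma T0_Ebar : X - T 0 = 4 * Ebar.
Proof.
rewrite /X /T /Ebar -linB; have -> p : 4 * p = 4 *: p :> P by rewrite mulr_natl scaler_nat.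
rewrite -linZ; congr lin; rewrite /tv /xg /t0 opprB scalerA.
by rewrite addrC addrA subrK -scalerDl; congr (_ *: _).
Qed.

Lemma lin_ev (a : 'I_5) : lin (ev a) = T a.+1 - 2 * Ebar.
Proof.
rewrite /T /Ebar; have -> p : 2 * p = 2 *: p :> P by rewrite mulr_natl scaler_nat.
rewrite -linZ -linB; congr lin; rewrite /tv inord_val /ti scalerA.
by rewrite -addrA -scalerBl -[LHS]addr0; congr (_ + _); rewrite (_ : _ - _ = 0) ?scale0r.
Qed.

Lemma lin_ev2 (a b : 'I_5) : lin (ev a + ev b) = T a.+1 + T b.+1 - (X - T 0).
Proof. by rewrite T0_Ebar linD !lin_ev; ring. Qed.

Lemma lin_tbar : lin tbar = X - T 0.
Proof. by rewrite tbar_wt lin_wtA. Qed.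

Lemma tau_wt p : tau (wt p) = X - T 0 - lin (wt p).
Proof. by rewrite /tau linB lin_tbar. Qed.

Lemma lin_VA (n : 'I_5) v : lin (- ev n + Ssum + (1/6) *: EE - v) = X - T n.+1 - lin v.
Proof.
rewrite linB -lin_wtA; congr (lin _ - _).
rewrite /wt /= inord_val /xg /ti opprD addrACA -scalerBl.
by rewrite [- _ + Ssum]addrC; congr (_ + _ *: _).
Qed.

Lemma lin_neg2 (n k : 'I_5) : lin (- ev n - ev k + (Ssum + (1/2) *: EE)) =
  2 * X - T 0 - T n.+1 - T k.+1.
Proof. by rewrite -/xg linD -/X -opprD linN lin_ev2; ring. Qed.

Lemma es_index_ord (F : 'I_5 -> P) k :
  es k [seq F i | i <- index_enum 'I_5] = es k [seq F (inord n) | n <- iota 0 5].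
Proof.
rewrite (map_comp F inord); apply/es_perm/perm_map/uniq_perm.
- exact: index_enum_uniq.
- rewrite map_inj_in_uniq ?iota_uniq // => m n; rewrite !mem_iota => hm hn.
  by move/(congr1 val); rewrite /= !inordK.
- move=> i; rewrite mem_index_enum; apply/esym/mapP; exists (val i).
    by rewrite mem_iota /=.
  by rewrite inord_val.
Qed.

Lemma omega_wt_VC0 (j : 'I_5) : omega (wt (VC 0 j.+1)) = omv (VC 0 j.+1).
Proof.
rewrite -wt_pos omega_posE wt_pos /omega_pos.
under eq_bigr do rewrite lin_VA lin_wtC.
rewrite /omv /rest2; move: (T) (X) => t x.
by case: j => [[|[|[|[|[|]]]]] hj] //=;
  rewrite big_mkcond !big_ord_recl big_ord0 !big_cons big_nil /= /bump /=; ring.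
Qed.

Lemma omega_wt_VC i j : (0 < i < j)%N -> (j < 6)%N -> omega (wt (VC i j)) = omv (VC i j).
Proof.
move=> i0j j6; rewrite -wt_sgC // omega_half ?card_sgC // wt_sgC //.
rewrite /omega_odd card_sgC // tau_wt lin_wtC /=.
under eq_bigr do under eq_bigr do rewrite lin_ev2.
have := T0E; move: (T) (X) => t x e0; move: i0j => /andP[i0 ij].
case: j j6 ij => [|[|[|[|[|[|j]]]]]] // _; case: i i0 => [|[|[|[|[|[|i]]]]]] // _ _ /=.
all: rewrite big_mkcond !big_ord_recl big_ord0 /=.
all: rewrite !inE !ffunE /= /bump /=.
all: rewrite !(big_mkcond (fun b => (b \in _) && _)) !big_ord_recl !big_ord0 /=.
all: rewrite !inE !ffunE /= /bump /= !big_cons big_nil; ring : e0.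
Qed.

Lemma lin_ev_seq :
  [seq lin (ev (inord n)) | n <- iota 0 5] = [seq T n.+1 - 2 * Ebar | n <- iota 0 5].
Proof.
by apply/eq_in_map => n; rewrite mem_iota lin_ev => hn; rewrite inordK.
Qed.

Lemma omega_VB0_identity (R : comNzRingType) (t0 t1 t2 t3 t4 t5 x k : R) :
  x - t0 = 4 * k -> t0 = 3 * x - t1 - t2 - t3 - t4 - t5 ->
  let e := [:: t1 - 2 * k; t2 - 2 * k; t3 - 2 * k; t4 - 2 * k; t5 - 2 * k] in
  let c k := es k [:: t0; t1; t2; t3; t4; t5] in
  (x - t0 + t0) * (es 1 e * es 2 e - es 3 e) =
  x * (2 * t0 ^+ 3 - 3 * t0 * x ^+ 2 - 5 * x ^+ 3 + (2 * x + t0) * c 2 - c 3).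
Proof.
move=> e1 e2; have {}e1 : t0 = x - 4 * k by rewrite -e1; ring.
have {e2}e5 : t5 = 2 * x + 4 * k - t1 - t2 - t3 - t4.
  by have -> : t5 = 3 * x - t1 - t2 - t3 - t4 - t0; [rewrite e2 | rewrite e1]; ring.
by rewrite /=; ring: e1 e5.
Qed.

Lemma omega_wt_VB0 : omega (wt (VB 0)) = omv (VB 0).
Proof.
rewrite -wt_sgB // omega_half ?card_sgB // wt_sgB // /omega_odd card_sgB // tau_wt lin_wtB opprK.
rewrite !esym_es !es_index_ord !lin_ev_seq.
exact: (omega_VB0_identity T0_Ebar T0E).
Qed.

Lemma omega_wt_VBS (j : 'I_5) : omega (wt (VB j.+1)) = omv (VB j.+1).
Proof.
rewrite -wt_neg omega_negE wt_neg /omega_neg -/xg -/X.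
under eq_bigr do rewrite lin_neg2.
rewrite lin_ev2 lin_VA tau_wt lin_wtB /omv /ct.
have := T0E; move: (T) (X) => t x e0.
case: j => [[|[|[|[|[|]]]]] hj] //=; rewrite !inordK //;
  rewrite big_mkcond !big_ord_recl big_ord0 /= -!val_eqE /= !inordK //= /bump /=; ring: e0.
Qed.

Lemma omega_wt p : p \in verts -> omega (wt p) = omv p.
Proof.
have ordS k : (0 < k < 6)%N -> exists j : 'I_5, k = j.+1.
  by case: k => // k hk; exists (Ordinal (hk : (k < 5)%N)).
rewrite vtx_okE; case: p => [[i|[i j]]|i] h.
- case: (posnP i) => [->|i0]; first by rewrite -tbar_wt /omega eqxx.
  have hi : (0 < i < 6)%N by rewrite i0.
  by rewrite -wt_sgA // omega_half ?odd_sgA // /omega_odd card_sgA.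
- case/andP: h => ij j6; case: (posnP i) => [i0|i0]; last by apply: omega_wt_VC; rewrite ?i0.
  have [|k ->] := ordS j; first by rewrite j6 -i0 (leq_ltn_trans _ ij).
  by rewrite i0; apply: omega_wt_VC0.
- case: (posnP i) => [->|i0]; first exact: omega_wt_VB0.
  by have [|k ->] := ordS i; [rewrite i0 | apply: omega_wt_VBS].
Qed.

(** * tau and omega are GKM functions *)

Definition divHBT (d F : P) : Prop := exists g, HBT g /\ F = d * g.

Lemma divHBT_opp d F : divHBT d F -> divHBT d (- F).
Proof. by move=> [g [hg ->]]; exists (- g); split; [apply: HBT_opp | rewrite mulrN]. Qed.

Lemma divHBT_oppl d F : divHBT (- d) F -> divHBT d F.
Proof. by move=> [g [hg ->]]; exists (- g); split; [apply: HBT_opp | rewrite mulrN mulNr]. Qed.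

Lemma divHBT_add d F G : divHBT d F -> divHBT d G -> divHBT d (F + G).
Proof.
by move=> [g [hg ->]] [h [hh ->]]; exists (g + h); split; [apply: HBT_add | rewrite mulrDr].
Qed.

Lemma divHBT_mulr d F c : HBT c -> divHBT d F -> divHBT d (F * c).
Proof.
by move=> hc [g [hg ->]]; exists (g * c); split; [apply: HBT_mul | rewrite mulrA].
Qed.

Definition congHBT d F G := divHBT d (F - G).

Lemma congHBT_refl d F : congHBT d F F.
Proof. by exists 0; split; [apply: HBT_0 | rewrite subrr mulr0]. Qed.

Lemma congHBT_add d F F' G G' : congHBT d F F' -> congHBT d G G' ->
  congHBT d (F + G) (F' + G').
Proof. by rewrite /congHBT opprD addrACA; apply: divHBT_add. Qed.

Lemma congHBT_opp d F F' : congHBT d F F' -> congHBT d (- F) (- F').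
Proof. by rewrite /congHBT -opprD; apply: divHBT_opp. Qed.

Lemma congHBT_mul d F F' G G' : HBT F' -> HBT G ->
  congHBT d F F' -> congHBT d G G' -> congHBT d (F * G) (F' * G').
Proof.
move=> hF' hG cF cG.
have -> : congHBT d (F * G) (F' * G') = divHBT d ((F - F') * G + (G - G') * F').
  by rewrite /congHBT !mulrBl (mulrC G) (mulrC G') addrA subrK.
by apply: divHBT_add; apply: divHBT_mulr.
Qed.

Lemma HBT_es k s : (forall x, x \in s -> HBT x) -> HBT (es k s).
Proof.
elim: s k => [|x s IHs] [|k] H /=; do ?[exact: HBT_1 | exact: HBT_0].
have hs y : y \in s -> HBT y by move=> hy; apply: H; rewrite inE hy orbT.
by apply: HBT_add; [|apply: HBT_mul]; do ?[exact: IHs]; apply: H; rewrite mem_head.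
Qed.

Lemma HBT_ct k : HBT (ct k).
Proof. by apply: HBT_es => x /mapP[i _ ->]; apply: HBT_T. Qed.

Ltac hbt := repeat first
  [ apply: HBT_X | apply: HBT_T | apply: HBT_ct | apply: HBT_nat | apply: HBT_1
  | apply: HBT_lin_wt | apply: HBT_add | apply: HBT_opp | apply: HBT_mul | apply: HBT_exp | done ].

Ltac cong := repeat first
  [ done | apply: congHBT_refl | apply: congHBT_add | apply: congHBT_opp | apply: congHBT_mul
  ].

(* The quotient P(z) / ((z - u) (z - v)) of P(z) = prod_n (z - t_n), for *)
(* s = u + v, p = u v, z = 2 x - s, and c_1 = 3 x, is q0 + q1 p + p^2. *)
Section Quartic.
Variable R : comNzRingType.

Definition q1 (x s c2 : R) : R :=
  - ((2 * x - s) * (2 * x - s)) + (3 * x - 2 * s) * (2 * x - s)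
  + (2 * 3 * x * s - 3 * (s * s) - c2).
Definition q0 (x s c2 c3 c4 : R) : R :=
  let z := 2 * x - s in
  let a1 := s - 3 * x in
  let a2 := s * a1 + c2 in
  let a3 := s * a2 - c3 in
  let a4 := s * a3 + c4 in
  (((z + a1) * z + a2) * z + a3) * z + a4.
Definition quartic (x s p c2 c3 c4 : R) : R := q0 x s c2 c3 c4 + q1 x s c2 * p + p * p.

Lemma quarticE (x u v a b c d : R) : u + v + a + b + c + d = 3 * x ->
  let cc k := es k [:: u; v; a; b; c; d] in
  \prod_(n <- [:: a; b; c; d]) (2 * x - u - v - n) =
  quartic x (u + v) (u * v) (cc 2) (cc 3) (cc 4).
Proof.
move=> e; have {e}-> : u = 3 * x - v - a - b - c - d by rewrite -e; ring.
by rewrite !big_cons big_nil /quartic /q0 /q1 /=; ring.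
Qed.

(** The label between C_ij and B_k is t_i + t_j + t_k - x. The cofactor is written out to show that
    it has integer coefficients; eliminating t_i by the relation that the six t_n sum to 3 x leaves
    a polynomial identity. *)
Lemma VC_VB_identity (x u v k a b c c2 c3 : R) : u + v + k + a + b + c = 3 * x ->
  c2 = es 2 [:: u; v; k; a; b; c] -> c3 = es 3 [:: u; v; k; a; b; c] ->
  \prod_(n <- [:: k; a; b; c]) (2 * x - u - v - n) -
  x * (2 * k ^+ 3 - 3 * k * x ^+ 2 - 5 * x ^+ 3 + (2 * x + k) * c2 - c3) =
  (u + v + k - x) *
  (x * ((u + v - 3 * x - k) * (k - x) - u * v - 2 * x * (2 * x - u - v))
   - ((2 * x - u - v) ^+ 2 * (k - x) + es 2 [:: a; b; c] * (2 * x - u - v) - es 3 [:: a; b; c])).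
Proof.
move=> e -> ->; have {e}-> : u = 3 * x - v - k - a - b - c by rewrite -e; ring.
by rewrite !big_cons big_nil /=; ring.
Qed.
End Quartic.

Lemma quartic_cong d s s' p p' : HBT s -> HBT s' -> HBT p -> HBT p' ->
  congHBT d s s' -> congHBT d p p' ->
  congHBT d (quartic X s p (ct 2) (ct 3) (ct 4)) (quartic X s' p' (ct 2) (ct 3) (ct 4)).
Proof.
move=> hs hs' hp hp' cs cp; rewrite /quartic /q0 /q1.
by cong; hbt.
Qed.

Lemma ct1 : ct 1 = 3 * X.
Proof. by rewrite /ct /= -sum_T !big_ord_recl big_ord0 /=; rewrite /bump /=; ring. Qed.

Lemma rest2_perm i j : (i < j < 6)%N -> exists a b c d,
  rest2 i j = [:: a; b; c; d] /\ perm_eq (iota 0 6) [:: i; j; a; b; c; d].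
Proof.
move=> ij; have : VC i j \in verts by rewrite vtx_okE.
have /allP H : all (fun p => if p is inl (inr (i, j)) then
    (size (rest2 i j) == 4) && perm_eq (iota 0 6) (i :: j :: rest2 i j) else true) verts by [].
move=> /H /andP[]; case: (rest2 i j) => [|a [|b [|c [|d [|]]]]] // _ h.
by exists a, b, c, d.
Qed.

Lemma rest2_perm3 i j k : (i < j < 6)%N -> (k < 6)%N -> k != i -> k != j -> exists a b c,
  perm_eq (rest2 i j) [:: k; a; b; c] /\ perm_eq (iota 0 6) [:: i; j; k; a; b; c].
Proof.
move=> ij hk ki kj; have [a [b [c [d [e pe]]]]] := rest2_perm ij.
have hk' : k \in [:: a; b; c; d] by rewrite -e mem_filter ki kj mem_iota.
have := perm_to_rem hk'; have : size (rem k [:: a; b; c; d]) = 3%N by rewrite size_rem.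
case: (rem _ _) => [|a' [|b' [|c' [|]]]] // _ per; exists a', b', c'; rewrite e; split => //.
by apply: (perm_trans pe); rewrite -![_ :: _ :: [:: _; _; _; _]]/([:: _; _] ++ _) perm_cat2l.
Qed.

Lemma ct_perm s k : perm_eq (iota 0 6) s -> ct k = es k (map T s).
Proof. by move=> h; apply: es_perm; apply: perm_map. Qed.

Lemma omvC i j : omv (VC i j) = \prod_(n <- rest2 i j) (2 * X - T i - T j - T n).
Proof. by []. Qed.

Lemma omvB i : omv (VB i) =
  X * (2 * T i ^+ 3 - 3 * T i * X ^+ 2 - 5 * X ^+ 3 + (2 * X + T i) * ct 2 - ct 3).
Proof. by []. Qed.

Lemma omv_VC i j : (i < j < 6)%N ->
  omv (VC i j) = quartic X (T i + T j) (T i * T j) (ct 2) (ct 3) (ct 4).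
Proof.
move=> /rest2_perm[a [b [c [d [e pe]]]]].
have ce n : ct n = es n [:: T i; T j; T a; T b; T c; T d] := ct_perm n pe.
rewrite omvC e -(big_map T xpredT (fun n => 2 * X - T i - T j - n)) !ce.
apply: quarticE.
by rewrite -ct1 ce /=; ring.
Qed.

Lemma VC_VB_dvd i j k : (i < j < 6)%N -> (k < 6)%N -> k != i -> k != j ->
  divHBT (T i + T j + T k - X) (omv (VC i j) - omv (VB k)).
Proof.
move=> ij hk ki kj; have [a [b [c [pe3 pe]]]] := rest2_perm3 ij hk ki kj.
have ce n : ct n = es n [:: T i; T j; T k; T a; T b; T c] := ct_perm n pe.
have hs : T i + T j + T k + T a + T b + T c = 3 * X by rewrite -ct1 ce /=; ring.
rewrite omvC omvB (perm_big _ pe3) -(big_map T xpredT (fun n => 2 * X - T i - T j - n)) [map _ _]/=.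
rewrite (VC_VB_identity hs (ce 2) (ce 3)); eexists; split; last by [].
have hes n : HBT (es n [:: T a; T b; T c]).
  by apply: HBT_es => x; rewrite !inE => /or3P[] /eqP->; apply: HBT_T.
by move: (es 2 _) (es 3 _) (hes 2) (hes 3) => e2 e3 h2 h3; hbt.
Qed.

Lemma VB_VB_dvd i j : divHBT (T i - T j) (omv (VB i) - omv (VB j)).
Proof.
rewrite !omvB; exists (X * (2 * (T i ^+ 2 + T i * T j + T j ^+ 2) - 3 * X ^+ 2 + ct 2)).
split; first by hbt.
by move: (T i) (T j) (ct 2) (ct 3) (X) => u v c d x; ring.
Qed.

Definition share (i j k l : nat) := [|| i == k, i == l, j == k | j == l].

Definition adjacent (p q : vtx) : bool := dotc (subc (wc p) (wc q)) (subc (wc p) (wc q)) == 2.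

(** In terms of the 27 lines on a cubic surface, adjacency is skewness, and these are the incidences
    of a double six. *)
Definition adjacent_spec (p q : vtx) : bool :=
  match p, q with
  | inl (inl i), inr j | inr j, inl (inl i) => i == j
  | inl (inl n), inl (inr (i, j)) | inl (inr (i, j)), inl (inl n) => (n != i) && (n != j)
  | inl (inr (i, j)), inr k | inr k, inl (inr (i, j)) => (k != i) && (k != j)
  | inl (inr (i, j)), inl (inr (k, l)) => share i j k l
  | _, _ => true
  end.

Lemma adjacentP p q : p \in verts -> q \in verts -> adjacent p q -> adjacent_spec p q.
Proof.
have H : all (fun p => all (fun q => adjacent p q ==> adjacent_spec p q) verts) verts.
  by vm_compute.
by move=> hp hq; apply/implyP; apply: (allP (allP H p hp) q hq).
Qed.

(** For pairs {u, v} and {u, w} the label is v - w, modulo which both the sums and the products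
    agree; omega depends on nothing else. *)
Lemma VC_VC_dvd i j k l : (i < j < 6)%N -> (k < l < 6)%N -> share i j k l ->
  divHBT (lin (wt (VC i j)) - lin (wt (VC k l))) (omv (VC i j) - omv (VC k l)).
Proof.
move=> ij kl sh; rewrite !omv_VC // !lin_wtC.
have one u v w : HBT u -> HBT v -> HBT w -> divHBT (u + v - X - (u + w - X))
    (quartic X (u + v) (u * v) (ct 2) (ct 3) (ct 4)
     - quartic X (u + w) (u * w) (ct 2) (ct 3) (ct 4)).
  move=> hu hv hw; apply: quartic_cong; hbt.
    by exists 1; split; [apply: HBT_1 | ring].
  by exists u; split => //; ring.
case/or4P: sh => /eqP e.
- by rewrite e; apply: one; apply: HBT_T.
- by rewrite e [T k + T l]addrC [T k * T l]mulrC; apply: one; apply: HBT_T.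
- by rewrite e [T i + T k]addrC [T i * T k]mulrC; apply: one; apply: HBT_T.
- by rewrite e [T k + T l]addrC [T k * T l]mulrC [T i + T l]addrC [T i * T l]mulrC;
    apply: one; apply: HBT_T.
Qed.

Lemma VA_VC_dvd n i j : (n < 6)%N -> n != i -> n != j ->
  divHBT (lin (wt (VA n)) - lin (wt (VC i j))) (omv (VC i j)).
Proof.
move=> hn ni nj; rewrite omvC lin_wtA lin_wtC.
have hn' : n \in rest2 i j by rewrite mem_filter ni nj mem_iota.
rewrite (big_rem _ hn') /=; eexists; split; last first.
  by congr (_ * _); ring.
by apply: HBT_prod => m _; hbt.
Qed.

Lemma omv_dvd p q : p \in verts -> q \in verts -> adjacent_spec p q ->
  divHBT (lin (wt p) - lin (wt q)) (omv p - omv q).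
Proof.
have sym d F G d' : d' = - d -> divHBT d (F - G) -> divHBT d' (G - F).
  by move=> -> /divHBT_opp; rewrite opprB => h; apply: divHBT_oppl; rewrite opprK.
have AB i : divHBT (lin (wt (VA i)) - lin (wt (VB i))) (omv (VA i) - omv (VB i)).
  rewrite lin_wtA lin_wtB opprK subrK sub0r omvB; apply: divHBT_opp.
  by eexists; split; last by []; hbt.
have AC n i j : (n < 6)%N -> n != i -> n != j ->
    divHBT (lin (wt (VA n)) - lin (wt (VC i j))) (omv (VA n) - omv (VC i j)).
  by move=> hn ni nj; rewrite sub0r; apply/divHBT_opp/VA_VC_dvd.
have CB i j k : (i < j < 6)%N -> (k < 6)%N -> k != i -> k != j ->
    divHBT (lin (wt (VC i j)) - lin (wt (VB k))) (omv (VC i j) - omv (VB k)).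
  by move=> ij hk ki kj; rewrite lin_wtC lin_wtB opprK addrAC; apply: VC_VB_dvd.
have oppB (u v : P) : u - v = - (v - u) by rewrite opprB.
rewrite !vtx_okE; case: p => [[i|[i j]]|i]; case: q => [[k|[k l]]|k] hp hq.
- by move=> _; exists 0; split; [apply: HBT_0 | rewrite /= subrr mulr0].
- by case/andP => ik il; apply: AC.
- by move=> /eqP ->; apply: AB.
- by case/andP => ik il; apply: (sym _ _ _ _ (oppB _ _)); apply: AC.
- exact: VC_VC_dvd.
- by case/andP => ki kj; apply: CB.
- by move=> /eqP <-; apply: (sym _ _ _ _ (oppB _ _)); apply: AB.
- by case/andP => ik il; apply: (sym _ _ _ _ (oppB _ _)); apply: CB.
- move=> _; rewrite !lin_wtB opprK addrC; apply: divHBT_oppl; rewrite opprB.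
  exact: VB_VB_dvd.
Qed.

Lemma GKM_of_dvd f : (forall p, p \in verts -> HBT (f (wt p))) ->
  (forall p q, p \in verts -> q \in verts -> adjacent p q ->
     divHBT (lin (wt p) - lin (wt q)) (f (wt p) - f (wt q))) ->
  GKM f.
Proof.
move=> h1 h2; split=> [v /inLambda_wt[p hp ->]|u v a /edge_root]; first exact: h1.
move=> [p [q [r [[hp hq hr] [-> -> e er]]]]].
have adj : adjacent p q.
  by rewrite /adjacent -dotcE vecc_sub -!wtE // e dotcE root_sq.
have := h2 p q hp hq adj; rewrite -linB e; case: er => -> //.
exact: divHBT_oppl.
Qed.

Lemma GKM_tau : GKM tau.
Proof.
apply: GKM_of_dvd => [p hp|p q hp hq _]; rewrite !tau_wt; first by hbt.
exists (- 1); split; first by hbt.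
by move: (lin (wt p)) (lin (wt q)) (X) (T 0) => u v x t; ring.
Qed.

Lemma HBT_omv p : HBT (omv p).
Proof.
case: p => [[i|[i j]]|i]; first exact: HBT_0.
- by rewrite -/(VC i j) omvC; apply: HBT_prod => n _; hbt.
- by rewrite -/(VB i) omvB; hbt.
Qed.

Lemma GKM_omega : GKM omega.
Proof.
apply: GKM_of_dvd => [p hp|p q hp hq adj]; rewrite !omega_wt //; first exact: HBT_omv.
by apply: omv_dvd => //; apply: adjacentP.
Qed.

(** * The class supported on the last clique *)

Section LastClass.
Variable R : comNzRingType.
Variables (x s D w c2 c3 c4 c5 c6 : R).

(* On the vertices t_i + t_j - x, where D = w (z^2 - z s + p) and *)
(* w = q0 + q1 p + p^2 with z = 2 x - s and p = t_i t_j, these are w p, w p^2, *)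
(* w p^3.  The relations used are those of the Grassmannian Gr(2,6): *)
(* the remainder of P(z) modulo z^2 - s z + p vanishes. *)
Definition wp1 : R := D - w * ((2 * x - s) * (2 * x - s) - (2 * x - s) * s).
Definition wp2 : R := w * w - w * q0 x s c2 c3 c4 - wp1 * q1 x s c2.
Definition wp3 : R :=
  w * c6 - wp1 * ((((s - 3 * x) * s + c2) * s - c3) * s + c4)
  + wp2 * (3 * (s * s) - 2 * 3 * x * s + c2).
(** This is w p times the z-coefficient of the remainder of P(z) modulo z^2 - s z + p, expanded in
    powers of p; [wp3] has used up the constant coefficient. The factor p brings the polynomial
    degree to 6 + 5 = 11, the number of labels from B_k towards the A_i and C_ij. *)
Definition last_class : R :=
  wp1 * (((((s - 3 * x) * s + c2) * s - c3) * s + c4) * s - c5)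
  + wp2 * (3 * 3 * x * (s * s) - 4 * (s * s * s) - 2 * c2 * s + c3)
  + wp3 * (3 * s - 3 * x).

Lemma last_class_VA : D = 0 -> w = 0 -> last_class = 0.
Proof. by move=> hD hw; rewrite /last_class /wp3 /wp2 /wp1 hD hw; ring. Qed.

Lemma wp1_VC p : D = w * ((2 * x - s) * (2 * x - s) - (2 * x - s) * s + p) -> wp1 = w * p.
Proof. by move=> hD; rewrite /wp1 hD; ring. Qed.

Lemma wp2_VC p : wp1 = w * p -> w = quartic x s p c2 c3 c4 -> wp2 = w * (p * p).
Proof.
move=> h1 hw; rewrite /wp2 h1.
have {1}-> : w = q0 x s c2 c3 c4 + q1 x s c2 * p + p * p by rewrite {1}hw.
by move: (q0 _ _ _ _ _) (q1 _ _ _) => a b; ring.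
Qed.
End LastClass.

Lemma last_class_VC (R : comNzRingType) (x u v a b c d D w c2 c3 c4 c5 c6 : R) :
  let s := u + v in
  3 * x = u + v + a + b + c + d ->
  c2 = es 2 [:: u; v; a; b; c; d] -> c3 = es 3 [:: u; v; a; b; c; d] ->
  c4 = es 4 [:: u; v; a; b; c; d] -> c5 = es 5 [:: u; v; a; b; c; d] ->
  c6 = es 6 [:: u; v; a; b; c; d] ->
  D = w * ((2 * x - s) * (2 * x - s) - (2 * x - s) * s + u * v) ->
  w = quartic x s (u * v) c2 c3 c4 ->
  last_class x s D w c2 c3 c4 c5 c6 = 0.
Proof.
move=> s e e2 e3 e4 e5 e6 hD hw; have h1 := wp1_VC hD; have h2 := wp2_VC h1 hw.
rewrite /last_class /wp3 h1 h2 e2 e3 e4 e5 e6 -!mulrA e /s /=.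
have {e}-> : u = 3 * x - v - a - b - c - d by rewrite e; ring.
by ring.
Qed.

Lemma last_class_VB (R : comNzRingType) (x t a b c d e c2 c3 c4 c5 c6 : R) :
  let D := - x * \prod_(n <- [:: a; b; c; d; e]) (n - (t + x)) in
  let w := x * (2 * t ^+ 3 - 3 * t * x ^+ 2 - 5 * x ^+ 3 + (2 * x + t) * c2 - c3) in
  let r y z := y + z + t - x in
  t + a + b + c + d + e = 3 * x ->
  c2 = es 2 [:: t; a; b; c; d; e] -> c3 = es 3 [:: t; a; b; c; d; e] ->
  c4 = es 4 [:: t; a; b; c; d; e] -> c5 = es 5 [:: t; a; b; c; d; e] ->
  c6 = es 6 [:: t; a; b; c; d; e] ->
  last_class x (x - t) D w c2 c3 c4 c5 c6 =
  - (x * (r a b * r a c * r a d * r a e * r b c * r b d * r b e * r c d * r c e * r d e)).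
Proof.
move=> D w r h e2 e3 e4 e5 e6.
rewrite /last_class /wp3 /wp2 /wp1 /q0 /q1 /D /w /r e2 e3 e4 e5 e6 /= !big_cons big_nil.
have -> : t = 3 * x - a - b - c - d - e by rewrite -h; ring.
ring.
Qed.

(** * The algebra generated by tau and omega *)

Definition Gen (f : vec -> P) : Prop :=
  exists cs : seq (P * nat * nat),
    (forall c, c \in cs -> HBT c.1.1) /\
    (forall v, inLambda v ->
       f v = \sum_(c <- cs) c.1.1 * tau v ^+ c.1.2 * omega v ^+ c.2).

Lemma Gen_ext f g : Gen g -> (forall v, inLambda v -> f v = g v) -> Gen f.
Proof. by move=> [cs [h e]] fg; exists cs; split=> // v hv; rewrite fg // e. Qed.

Lemma Gen_monomial c a b : HBT c -> Gen (fun v => c * tau v ^+ a * omega v ^+ b).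
Proof.
move=> hc; exists [:: (c, a, b)]; split; first by move=> d; rewrite inE => /eqP ->.
by move=> v _; rewrite big_seq1.
Qed.

Lemma Gen_const c : HBT c -> Gen (fun=> c).
Proof.
by move=> hc; apply: (Gen_ext (Gen_monomial 0 0 hc)) => v _; rewrite !expr0 !mulr1.
Qed.

Lemma Gen_tau : Gen tau.
Proof.
by apply: (Gen_ext (Gen_monomial 1 0 HBT_1)) => v _; rewrite expr0 mulr1 mul1r.
Qed.

Lemma Gen_omega : Gen omega.
Proof.
by apply: (Gen_ext (Gen_monomial 0 1 HBT_1)) => v _; rewrite expr0 mul1r mul1r.
Qed.

Lemma Gen_add f g : Gen f -> Gen g -> Gen (fun v => f v + g v).
Proof.
move=> [cs [hc ec]] [ds [hd ed]]; exists (cs ++ ds); split.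
  by move=> c; rewrite mem_cat => /orP[/hc | /hd].
by move=> v hv; rewrite big_cat /= ec // ed.
Qed.

Lemma Gen_mul f g : Gen f -> Gen g -> Gen (fun v => f v * g v).
Proof.
move=> [cs [hc ec]] [ds [hd ed]].
exists [seq (c.1.1 * d.1.1, (c.1.2 + d.1.2)%N, (c.2 + d.2)%N) | c <- cs, d <- ds]; split.
  by move=> _ /allpairsP[[c d] [/hc hc' /hd hd' ->]]; apply: HBT_mul.
move=> v hv; rewrite big_allpairs_dep /= ec // ed // mulr_suml.
apply: eq_bigr => c _; rewrite mulr_sumr; apply: eq_bigr => d _.
rewrite !exprD; move: (tau v ^+ _) (tau v ^+ _) (omega v ^+ _) (omega v ^+ _) (c.1.1) (d.1.1).
by move=> *; ring.
Qed.

Lemma Gen_opp f : Gen f -> Gen (fun v => - f v).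
Proof.
move=> hf; apply: (Gen_ext (Gen_mul (Gen_const (HBT_opp HBT_1)) hf)) => v _.
by rewrite mulN1r.
Qed.

(** As a function of the vertex, [lin] is the class sigma = tbar - tau. *)
Lemma Gen_lin : Gen lin.
Proof.
apply: (Gen_ext (Gen_add (Gen_const (HBT_lin_wt (VA 0))) (Gen_opp Gen_tau))) => v _.
by rewrite -tbar_wt /tau linB opprB addrC subrK.
Qed.

Lemma Gen_prod (I : Type) (s : seq I) (F : I -> vec -> P) :
  (forall i, Gen (F i)) -> Gen (fun v => \prod_(i <- s) F i v).
Proof.
move=> H; elim: s => [|i s IHs].
  by apply: (Gen_ext (Gen_const HBT_1)) => v _; rewrite big_nil.
by apply: (Gen_ext (Gen_mul (H i) IHs)) => v _; rewrite big_cons.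
Qed.

Ltac gen := repeat first
  [ apply: Gen_lin | apply: Gen_omega | apply: Gen_add | apply: Gen_opp | apply: Gen_mul
  | by apply: Gen_const; hbt ].

(** * GKM functions form an algebra *)

Lemma GKM_add f g : GKM f -> GKM g -> GKM (fun v => f v + g v).
Proof.
move=> [hf ef] [hg eg]; split=> [v hv|u v a huv]; first by apply: HBT_add; auto.
by apply: congHBT_add; [apply: ef | apply: eg].
Qed.

Lemma GKM_mul f g : GKM f -> GKM g -> GKM (fun v => f v * g v).
Proof.
move=> [hf ef] [hg eg]; split=> [v hv|u v a huv]; first by apply: HBT_mul; auto.
have /and5P[hu hv _ _ _] := huv.
by apply: congHBT_mul; auto; [apply: ef | apply: eg].
Qed.

Lemma GKM_const c : HBT c -> GKM (fun=> c).
Proof. by move=> hc; split=> // u v a _; apply: congHBT_refl. Qed.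

Lemma GKM_ext f g : GKM g -> (forall v, inLambda v -> f v = g v) -> GKM f.
Proof.
move=> [hg eg] fg; split=> [v hv|u v a huv]; first by rewrite fg //; apply: hg.
by have /and5P[hu hv _ _ _] := huv; rewrite !fg //; apply: eg.
Qed.

Lemma GKM_Gen f : Gen f -> GKM f.
Proof.
have GKM_exp g n : GKM g -> GKM (fun v => g v ^+ n).
  move=> hg; elim: n => [|n IHn]; first exact: GKM_const HBT_1.
  by apply: (GKM_ext (GKM_mul hg IHn)) => v _; rewrite exprS.
move=> [cs [hc ec]]; apply: (GKM_ext _ ec) => {f ec}.
elim: cs hc => [|c cs IHcs] hc.
  by apply: (GKM_ext (GKM_const HBT_0)) => v _; rewrite big_nil.
have h : GKM (fun v => c.1.1 * tau v ^+ c.1.2 * omega v ^+ c.2).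
  apply: GKM_mul; last exact: GKM_exp GKM_omega.
  apply: GKM_mul; last exact: GKM_exp GKM_tau.
  by apply/GKM_const/hc/mem_head.
have {}IHcs := IHcs (fun d hd => hc d (@mem_behead _ (c :: cs) d hd)).
by apply: (GKM_ext (GKM_add h IHcs)) => v _; rewrite big_cons.
Qed.

(** * Flow-up classes *)

Definition earlier (p : vtx) : seq vtx := take (index p verts) verts.

Definition pairs_except (k : nat) := [seq q <- pairs | (q.1 != k) && (q.2 != k)].

(* Up to sign, the labels of the edges joining [p] to earlier vertices. *)
Definition below (p : vtx) : seq crd :=
  match p with
  | inl (inl k) => [seq subc (tc i) (tc k) | i <- iota 0 k]
  | inl (inr (i, j)) =>
      [seq subc (subc (subc (scalec 2 xc) (tc i)) (tc j)) (tc n) | n <- rest2 i j]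
      ++ [seq subc (tc i) (tc l) | l <- iota 0 i]
      ++ [seq subc (tc j) (tc l) | l <- iota 0 i]
      ++ [seq subc (tc j) (tc l) | l <- iota i.+1 (j - i.+1)]
  | inr k =>
      xc :: [seq subc (addc (addc (tc q.1) (tc q.2)) (tc k)) xc
              | q <- pairs_except k]
      ++ [seq subc (tc i) (tc k) | i <- iota 0 k]
  end.

(** Pairing 1 with the root [b] means that its reflection carries [p] to [p - b], that is, to
    [q]. *)
Definition labelled (p q : vtx) (b : crd) : bool :=
  (subc (wc p) (wc q) == b) && (dotc (wc p) b == 1).

Lemma GKM_labelled f p q b : GKM f -> p \in verts -> q \in verts -> b \in e6roots ->
  labelled p q b -> divHBT (lin (vecc b)) (f (wt p) - f (wt q)).
Proof.
move=> [_ ef] hp hq hb /andP[/eqP eb /eqP db].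
have eb' : wt p - wt q = vecc b by rewrite !wtE // -vecc_sub eb.
have npq : wt p != wt q.
  apply/eqP => e; have := root_sq hb; rewrite -dotcE -eb' e subrr.
  by rewrite dot0l.
have dp : dot (wt p) (vecc b) = 1 by rewrite wtE // dotcE.
have mk c : c \in rootL -> refl (vecc c) (wt p) = wt q ->
    divHBT (lin (vecc c)) (f (wt p) - f (wt q)).
  move=> hc hr; apply: ef.
  by rewrite /edge !wt_inLambda // npq rootL_posRoot // hr eqxx.
move: (hb); rewrite mem_cat => /orP[hc|/mapP[c hc e]].
  apply: mk => //; rewrite /refl dp dotcE root_sq // -eb'.
  by rewrite (_ : _ / _ = 1) // scale1r opprB addrC subrK.
have hc' : c \in e6roots by rewrite mem_cat hc.
have ebc : vecc c = - vecc b by rewrite e vecc_scale scaleN1r opprK.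
rewrite e lin_vecc_opp; apply: divHBT_oppl; rewrite opprK; apply: mk => //.
have dpc : dot (wt p) (vecc c) = -1 by rewrite ebc dotC -scaleN1r dotZl dotC dp mulr1.
rewrite /refl dpc dotcE root_sq // (_ : _ / _ = -1) // scaleN1r opprK ebc -eb'.
by rewrite opprB addrC subrK.
Qed.

Definition below_ok (p : vtx) : bool :=
  [&& all (fun b => (b \in e6roots) &&
             has (fun q => labelled p q b || labelled q p b) (earlier p)) (below p)
    & pairwise coprimec (below p)].

Lemma belowP p : p \in verts -> below_ok p.
Proof.
have /allP H : all below_ok verts by vm_compute.
exact: H.
Qed.

(** Triangular elimination along [verts]. The factor [eps] absorbs the sign between a class and the
    product of [below], whose entries are labels only up to sign. *)
Lemma flow_criterion :
  (forall p, p \in verts -> exists r eps, [/\ Gen r, HBT eps,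
     forall q, q \in earlier p -> r (wt q) = 0 &
     \prod_(b <- below p) lin (vecc b) = eps * r (wt p)]) ->
  forall f, GKM f -> Gen f.
Proof.
move=> flow f hf.
have step n : (n <= size verts)%N ->
    exists2 r, Gen r & forall q, q \in take n verts -> f (wt q) = r (wt q).
  elim: n => [|n IHn] hn; first by exists (fun=> 0) => //; apply/Gen_const/HBT_0.
  have [r hr er] := IHn (ltnW hn).
  pose p := nth (VA 0) verts n; have hp : p \in verts by apply: mem_nth.
  have ep : earlier p = take n verts by rewrite /earlier index_uniq.
  have [g [eps [hg heps g0 gp]]] := flow p hp.
  pose F v := f v + - r v.
  have hF : GKM F by apply: GKM_add => //; apply/GKM_Gen/Gen_opp.
  have /andP[/allP bp cp] := belowP hp.
  have [b /bp /andP[] // | | | b /bp /andP[hb /hasP[q hq lq]] | c [hc ec]] :=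
    @root_prod_dvd (below p) (F (wt p)).
  - by have [h _] := hF; apply/h/wt_inLambda.
  - by [].
  - have hq' : q \in verts by apply: (mem_take hq).
    have F0 : F (wt q) = 0 by rewrite /F er ?subrr // -ep.
    (* The difference [F] vanishes at the lower end of the edge, so the edge condition makes the
       label divide its value at [p]. *)
    case/orP: lq => /(GKM_labelled hF) H.
      by have := H hp hq' hb; rewrite F0 subr0.
    by have /divHBT_opp := H hq' hp hb; rewrite F0 sub0r opprK.
  (* The quotient [c] times the flow-up class corrects the value at [p] and leaves the earlier
     vertices untouched. *)
  exists (fun v => r v + c * eps * g v).
    by apply: Gen_add => //; apply: Gen_mul => //; apply: Gen_const; apply: HBT_mul.
  move=> q; rewrite (take_nth (VA 0)) // -/p mem_rcons inE => /orP[/eqP -> | hq].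
    have : F (wt p) = c * eps * g (wt p) by rewrite ec gp mulrC mulrA.
    by rewrite /F => <-; rewrite addrC subrK.
  by rewrite g0 ?ep // mulr0 addr0 er.
have [r hr er] := step _ (leqnn _); apply: (Gen_ext hr) => v /inLambda_wt[p hp ->].
by apply: er; rewrite take_size.
Qed.

(** * The class vanishing on all A_i and C_ij *)

Definition svar (v : vec) : P := lin v + X.
Definition dprod (v : vec) : P := \prod_(i <- iota 0 6) (lin v - (X - T i)).
Definition pomega (v : vec) : P := wp1 X (svar v) (dprod v) (omega v).
Definition last_cls (v : vec) : P :=
  last_class X (svar v) (dprod v) (omega v) (ct 2) (ct 3) (ct 4) (ct 5) (ct 6).

Lemma Gen_svar : Gen svar.
Proof. by apply: Gen_add; [apply: Gen_lin | apply/Gen_const/HBT_X]. Qed.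

Lemma Gen_dprod : Gen dprod.
Proof. by apply: Gen_prod => i; gen. Qed.

Ltac gen_svar := repeat first
  [ done | apply: Gen_svar | apply: Gen_dprod | apply: Gen_omega
  | by apply: Gen_const; hbt
  | apply: Gen_add | apply: Gen_opp | apply: Gen_mul ].

Lemma Gen_q0 : Gen (fun v => q0 X (svar v) (ct 2) (ct 3) (ct 4)).
Proof. by rewrite /q0; gen_svar. Qed.

Lemma Gen_q1 : Gen (fun v => q1 X (svar v) (ct 2)).
Proof. by rewrite /q1; gen_svar. Qed.

Lemma Gen_pomega : Gen pomega.
Proof. by rewrite /pomega /wp1; gen_svar. Qed.

Lemma Gen_wp2 : Gen (fun v => wp2 X (svar v) (dprod v) (omega v) (ct 2) (ct 3) (ct 4)).
Proof.
apply: Gen_add.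
  apply: Gen_add; first by gen_svar.
  by apply/Gen_opp/Gen_mul; [apply: Gen_omega | apply: Gen_q0].
by apply/Gen_opp/Gen_mul; [apply: Gen_pomega | apply: Gen_q1].
Qed.

Lemma Gen_last_cls : Gen last_cls.
Proof.
have hp := Gen_pomega; have h2 := Gen_wp2.
have h3 : Gen (fun v => wp3 X (svar v) (dprod v) (omega v) (ct 2) (ct 3) (ct 4) (ct 6)).
  by apply: Gen_add; [apply: Gen_add; [|apply: Gen_opp] |]; apply: Gen_mul => //; gen_svar.
by apply: Gen_add; [apply: Gen_add|]; apply: Gen_mul => //; gen_svar.
Qed.

Lemma svar_VC i j : svar (wt (VC i j)) = T i + T j.
Proof. by rewrite /svar lin_wtC subrK. Qed.

Lemma VC_verts i j : (i < j < 6)%N -> VC i j \in verts.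
Proof. by rewrite vtx_okE. Qed.

Lemma dprod_VA i : (i < 6)%N -> dprod (wt (VA i)) = 0.
Proof.
move=> hi; have hi' : i \in iota 0 6 by rewrite mem_iota.
by rewrite /dprod (big_rem _ hi') /= lin_wtA subrr mul0r.
Qed.

(** Of the six factors, the four with n outside {i, j} are those of omega with an even number of
    sign changes; the other two are t_i - z and t_j - z for z = 2 x - s. *)
Lemma dprod_VC_identity (R : comNzRingType) (x u v a b c d : R) :
  \prod_(n <- [:: u; v; a; b; c; d]) (u + v - x - (x - n)) =
  \prod_(n <- [:: a; b; c; d]) (2 * x - u - v - n) *
    ((2 * x - (u + v)) * (2 * x - (u + v)) - (2 * x - (u + v)) * (u + v) + u * v).
Proof. by rewrite !big_cons !big_nil; ring. Qed.

Lemma dprod_VC i j : (i < j < 6)%N ->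
  let s := T i + T j in
  dprod (wt (VC i j)) = omv (VC i j) * ((2 * X - s) * (2 * X - s) - (2 * X - s) * s + T i * T j).
Proof.
move=> ij s; have [a [b [c [d [e pe]]]]] := rest2_perm ij.
rewrite /dprod (perm_big _ pe) lin_wtC omvC e.
rewrite -(big_map T xpredT (fun n => 2 * X - T i - T j - n)).
rewrite -(big_map T xpredT (fun n => T i + T j - X - (X - n))).
exact: dprod_VC_identity.
Qed.

Lemma pomega_VC i j : (i < j < 6)%N -> pomega (wt (VC i j)) = omv (VC i j) * (T i * T j).
Proof.
move=> ij; rewrite /pomega omega_wt ?VC_verts // svar_VC.
exact: (wp1_VC (dprod_VC ij)).
Qed.

Lemma last_cls_VA i : (i < 6)%N -> last_cls (wt (VA i)) = 0.
Proof.
by move=> hi; apply: last_class_VA; [apply: dprod_VA | rewrite omega_wt ?vtx_okE].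
Qed.

Lemma last_cls_VC i j : (i < j < 6)%N -> last_cls (wt (VC i j)) = 0.
Proof.
move=> ij; have [a [b [c [d [_ pe]]]]] := rest2_perm ij.
have ce n : ct n = es n [:: T i; T j; T a; T b; T c; T d] := ct_perm n pe.
have hs : 3 * X = T i + T j + T a + T b + T c + T d by rewrite -ct1 ce /=; ring.
rewrite /last_cls svar_VC omega_wt ?VC_verts //.
exact: (last_class_VC hs (ce 2) (ce 3) (ce 4) (ce 5) (ce 6) (dprod_VC ij) (omv_VC ij)).
Qed.

Lemma pairs_except_prod k (F : nat -> nat -> P) : (k < 6)%N -> exists a b c d e,
  perm_eq (iota 0 6) [:: k; a; b; c; d; e] /\
  \prod_(q <- pairs_except k) F q.1 q.2 =
  F a b * F a c * F a d * F a e * F b c * F b d * F b e * F c d * F c e * F d e.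
Proof.
move=> hk; pose nk := [seq n <- iota 0 6 | n != k].
exists nk`_0, nk`_1, nk`_2, nk`_3, nk`_4.
case: k hk @nk => [|[|[|[|[|[|]]]]]] // _ nk; split => //;
  rewrite /pairs_except unlock /= mulr1 !mulrA //.
Qed.

Lemma last_cls_VB k : (k < 6)%N ->
  last_cls (wt (VB k)) = - (X * \prod_(q <- pairs_except k) (T q.1 + T q.2 + T k - X)).
Proof.
move=> hk.
have [a [b [c [d [e [pe ->]]]]]] := pairs_except_prod (fun i j => T i + T j + T k - X) hk.
have ce n : ct n = es n [:: T k; T a; T b; T c; T d; T e] := ct_perm n pe.
have hs : T k + T a + T b + T c + T d + T e = 3 * X by rewrite -ct1 ce /=; ring.
have eD : dprod (wt (VB k)) = - X * \prod_(n <- [:: T a; T b; T c; T d; T e]) (n - (T k + X)).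
  rewrite /dprod (perm_big _ pe) lin_wtB big_cons -(big_map T xpredT (fun n => - T k - (X - n))).
  rewrite [map _ _]/= !big_cons !big_nil /=.
  by move: (T k) (X) (T a) (T b) (T c) (T d) (T e) => *; ring.
have es : svar (wt (VB k)) = X - T k by rewrite /svar lin_wtB addrC.
have hv : VB k \in verts by rewrite vtx_okE.
rewrite /last_cls es eD (omega_wt hv) omvB.
exact: (last_class_VB hs (ce 2) (ce 3) (ce 4) (ce 5) (ce 6)).
Qed.

(** * Lifting omega F(s, p) to the algebra *)

Definition lifts (r : vec -> P) (F : P -> P -> P) : Prop :=
  [/\ Gen r, forall i, (i < 6)%N -> r (wt (VA i)) = 0 &
      forall i j, (i < j < 6)%N ->
        r (wt (VC i j)) = omv (VC i j) * F (T i + T j) (T i * T j)].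

(* Lifting F and p F together makes [liftable] stable under multiplication *)
(* by p, because p^2 F = omega F - q0 F - q1 (p F) on the t_i + t_j - x. *)
Definition liftable (F : P -> P -> P) : Prop :=
  (exists r, lifts r F) /\ (exists r, lifts r (fun s p => p * F s p)).

Lemma liftable1 : liftable (fun _ _ => 1).
Proof.
split; [exists omega | exists pomega]; split.
- exact: Gen_omega.
- by move=> i hi; rewrite omega_wt ?vtx_okE.
- by move=> i j hij; rewrite mulr1 omega_wt // VC_verts.
- exact: Gen_pomega.
- by move=> i hi; rewrite /pomega /wp1 dprod_VA // omega_wt ?vtx_okE //= mul0r subr0.
- by move=> i j hij; rewrite mulr1 pomega_VC.
Qed.

Lemma lifts_scale r F g G : lifts r F -> Gen g ->
  (forall i j, (i < j < 6)%N -> g (wt (VC i j)) = G (T i + T j) (T i * T j)) ->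
  lifts (fun v => g v * r v) (fun s p => G s p * F s p).
Proof.
move=> [hr r0 rF] hg gG; split; first exact: Gen_mul.
- by move=> i hi; rewrite r0 // mulr0.
- by move=> i j hij; rewrite rF // gG // mulrCA.
Qed.

Lemma lifts_add r F r' F' : lifts r F -> lifts r' F' ->
  lifts (fun v => r v + r' v) (fun s p => F s p + F' s p).
Proof.
move=> [hr r0 rF] [hr' r0' rF']; split; first exact: Gen_add.
- by move=> i hi; rewrite r0 // r0' // addr0.
- by move=> i j hij; rewrite rF // rF' // mulrDr.
Qed.

Lemma lifts_ext r F F' : (forall s p, F s p = F' s p) -> lifts r F -> lifts r F'.
Proof. by move=> e [hr r0 rF]; split=> // i j hij; rewrite rF // e. Qed.

Lemma liftable_ext F F' : (forall s p, F s p = F' s p) -> liftable F -> liftable F'.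
Proof.
move=> e [[r h] [r' h']]; split; first by exists r; apply: lifts_ext h.
by exists r'; apply: lifts_ext h' => s p; rewrite e.
Qed.

Lemma liftable_add F F' : liftable F -> liftable F' -> liftable (fun s p => F s p + F' s p).
Proof.
move=> [[r1 h1] [r2 h2]] [[r3 h3] [r4 h4]]; split.
  by eexists; apply: (lifts_add h1 h3).
eexists; apply: (lifts_ext _ (lifts_add h2 h4)) => s p; exact/esym/mulrDr.
Qed.

Lemma liftable_scale_s (a c : P) F : HBT a -> HBT c -> liftable F ->
  liftable (fun s p => (a * s + c) * F s p).
Proof.
move=> ha hc [[r1 h1] [r2 h2]].
have hg : Gen (fun v => a * svar v + c).
  by apply: Gen_add; [apply: Gen_mul; [|apply: Gen_svar]|]; apply: Gen_const.
have eg i j : (i < j < 6)%N -> a * svar (wt (VC i j)) + c = a * (T i + T j) + c.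
  by rewrite svar_VC.
split; first by eexists; apply: (lifts_scale (G := fun s _ => a * s + c) h1 hg eg).
eexists; apply: (lifts_ext _ (lifts_scale (G := fun s _ => a * s + c) h2 hg eg)) => s p.
exact: mulrCA.
Qed.

Lemma liftable_scale_p F : liftable F -> liftable (fun s p => p * F s p).
Proof.
move=> [[r1 h1] [r2 h2]]; split; first by exists r2.
pose G2 (s _ : P) := - q0 X s (ct 2) (ct 3) (ct 4).
pose G3 (s _ : P) := - q1 X s (ct 2).
have k1 := lifts_scale (G := fun s p => quartic X s p (ct 2) (ct 3) (ct 4)) h1 Gen_omega.
have k2 := lifts_scale (G := G2) h1 (Gen_opp Gen_q0).
have k3 := lifts_scale (G := G3) h2 (Gen_opp Gen_q1).
have {}k1 := k1 (fun i j hij => etrans (omega_wt (VC_verts hij)) (omv_VC hij)).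
have {}k2 := k2 (fun i j hij => congr1 (fun s => - q0 X s _ _ _) (svar_VC i j)).
have {}k3 := k3 (fun i j hij => congr1 (fun s => - q1 X s _) (svar_VC i j)).
eexists; apply: (lifts_ext _ (lifts_add (lifts_add k1 k2) k3)) => s p.
rewrite /quartic /G2 /G3; move: (q0 _ _ _ _ _) (q1 _ _ _) (F s p) => a b f; ring.
Qed.

Lemma liftable_prod_s (s0 : seq P) F : (forall a, a \in s0 -> HBT a) -> liftable F ->
  liftable (fun s p => \prod_(a <- s0) (s - a) * F s p).
Proof.
elim: s0 F => [|a s0 IHs] F hs hF.
  by apply: liftable_ext hF => s p; rewrite big_nil mul1r.
have {}IHs := IHs F (fun b hb => hs b (@mem_behead _ (a :: s0) b hb)) hF.
have ha := hs a (mem_head _ _).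
apply: (liftable_ext _ (liftable_scale_s HBT_1 (HBT_opp ha) IHs)) => s p.
by rewrite big_cons mul1r mulrA.
Qed.

Lemma liftable_prod_N (s0 : seq P) F : (forall a, a \in s0 -> HBT a) -> liftable F ->
  liftable (fun s p => \prod_(a <- s0) (p - s * a + a * a) * F s p).
Proof.
elim: s0 F => [|a s0 IHs] F hs hF.
  by apply: liftable_ext hF => s p; rewrite big_nil mul1r.
have {}IHs := IHs F (fun b hb => hs b (@mem_behead _ (a :: s0) b hb)) hF.
have ha := hs a (mem_head _ _).
have h := liftable_add (liftable_scale_p IHs)
  (liftable_scale_s (HBT_opp ha) (HBT_mul ha ha) IHs).
apply: (liftable_ext _ h) => s p; rewrite big_cons.
by move: (\prod_(_ <- _) _) (F s p) => b f; ring.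
Qed.

(** * The flow-up classes at the three families of vertices *)

Definition earlier_spec (p q : vtx) : bool :=
  match p, q with
  | inl (inl k), inl (inl n) => (n < k)%N
  | inl (inl k), _ => false
  | inl (inr (i, j)), inl (inl n) => (n < 6)%N
  | inl (inr (i, j)), inl (inr (a, b)) => (a < b < 6)%N && ((a < i)%N || (a == i) && (i < b < j)%N)
  | inl (inr (i, j)), inr _ => false
  | inr k, inl (inl n) => (n < 6)%N
  | inr k, inl (inr (a, b)) => (a < b < 6)%N
  | inr k, inr n => (n < k)%N
  end.

Lemma earlierP p q : p \in verts -> q \in earlier p -> earlier_spec p q.
Proof.
have /allP H : all (fun p => all (earlier_spec p) (earlier p)) verts by vm_compute.
by move=> /H /allP; apply.
Qed.

Definition has_flow (p : vtx) : Prop := exists r eps, [/\ Gen r, HBT eps,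
  forall q, q \in earlier p -> r (wt q) = 0 &
  \prod_(b <- below p) lin (vecc b) = eps * r (wt p)].

Lemma flow_VA k : (k < 6)%N -> has_flow (VA k).
Proof.
move=> hk; have hp : VA k \in verts by rewrite vtx_okE.
exists (fun v => \prod_(i <- iota 0 k) (lin v - (X - T i))), 1; split.
- by apply: Gen_prod => i; gen.
- exact: HBT_1.
- case=> [[n|[a b]]|n] /(earlierP hp) //= nk.
  have hn : n \in iota 0 k by rewrite mem_iota.
  by rewrite (big_rem _ hn) /= linB subrr mul0r.
- rewrite mul1r big_map; apply: eq_big_seq => i; rewrite mem_iota => /andP[_ ik].
  rewrite vecc_sub linB !lin_tc ?(ltn_trans ik) // lin_wtA.
  by move: (T i) (T k) (X) => *; ring.
Qed.

Lemma flow_VB k : (k < 6)%N -> has_flow (VB k).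
Proof.
move=> hk; have hp : VB k \in verts by rewrite vtx_okE.
(* The -1 cancels the sign in [last_cls_VB]; the remaining factors vanish at the earlier B_i and
   give the labels towards them. *)
exists (fun v => last_cls v * \prod_(i <- iota 0 k) (lin v + T i)), (- 1); split.
- apply: Gen_mul; first exact: Gen_last_cls.
  by apply: Gen_prod => i; gen.
- exact: HBT_opp HBT_1.
- case=> [[n|[a b]]|n] /(earlierP hp) h.
  + by rewrite last_cls_VA // mul0r.
  + by rewrite last_cls_VC // mul0r.
  + have hn : n \in iota 0 k by rewrite mem_iota.
    by rewrite (big_rem _ hn) /= linN addNr mul0r mulr0.
- have signs (a a' b b' c c' : P) : a = a' -> b = b' -> c = c' ->
      a * (b * c) = - 1 * (- (a' * b') * c').
    by move=> -> -> ->; rewrite mulN1r mulNr opprK mulrA.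
  rewrite (last_cls_VB hk) /below big_cons big_cat !big_map; apply: signs.
  + by rewrite -xgE.
  + apply: eq_big_seq => q; rewrite mem_filter => /andP[_ /pairs_lt /andP[q12 q2]].
    by rewrite vecc_sub linB -xgE -/X !vecc_add !linD !lin_tc // (ltn_trans q12).
  + apply: eq_big_seq => i; rewrite mem_iota => /andP[_ ik].
    by rewrite vecc_sub linB !lin_tc ?(ltn_trans ik) // lin_wtB addrC.
Qed.

Lemma flow_VC i j : (i < j < 6)%N -> has_flow (VC i j).
Proof.
move=> ij; have hp : VC i j \in verts by rewrite vtx_okE.
have /andP[lij hj] := ij; have hi := ltn_trans lij hj.
have hT (s : seq nat) a : a \in map T s -> HBT a by case/mapP => n _ ->; apply: HBT_T.
have hS (s : seq nat) a : a \in [seq T i + T l | l <- s] -> HBT a.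
  by case/mapP => n _ ->; hbt.
(* At C_ab the factor p - s t_l + t_l^2 is (t_a - t_l)(t_b - t_l), so the first product kills every
   C_ab with a < i; the second kills C_il for i < l < j. At C_ij they give the labels t_i - t_l and
   t_j - t_l, while omega gives those towards the A_n. *)
have [[r [hr r0 rF]] _] := liftable_prod_N (hT (iota 0 i))
  (liftable_prod_s (hS (iota i.+1 (j - i.+1))) liftable1).
exists r, 1; split => //; first exact: HBT_1.
- case=> [[n|[a b]]|n] /(earlierP hp) //; first exact: r0.
  rewrite /earlier_spec => /andP[hab]; rewrite (rF _ _ hab) !big_map mulr1.
  case/orP => [ai|/andP[/eqP -> /andP[ib bj]]].
    have ha : a \in iota 0 i by rewrite mem_iota.
    rewrite (big_rem _ ha) /= (_ : _ + T a * T a = 0) ?mul0r ?mulr0 //.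
    by move: (T a) (T b) => *; ring.
  have hb : b \in iota i.+1 (j - i.+1) by rewrite mem_iota ib subnKC.
  by rewrite (big_rem _ hb) /= subrr mul0r !mulr0.
- rewrite mul1r (rF _ _ ij) !big_map mulr1 /below !big_cat !big_map /=; congr (_ * _).
    apply: eq_big_seq => n; rewrite mem_filter mem_iota => /andP[_ hn].
    rewrite !vecc_sub vecc_scale !linB linZ -xgE -/X !lin_tc //.
    by rewrite mulr_natl scaler_nat.
  rewrite mulrA -big_split /=; congr (_ * _).
    apply: eq_big_seq => l; rewrite mem_iota => /andP[_ li].
    rewrite !vecc_sub !linB !lin_tc ?(ltn_trans li) //.
    by move: (T i) (T j) (T l) => *; ring.
  apply: eq_big_seq => l; rewrite mem_iota subnKC // => /andP[_ lj].
  rewrite vecc_sub linB !lin_tc ?(ltn_trans lj) //.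
  by move: (T i) (T j) (T l) => *; ring.
Qed.

(* H^*(G(EIII)) is generated as an H^*(BT)-algebra by tau and omega:
   tau and omega are GKM functions, and every GKM function f agrees on all
   vertices with a polynomial in tau, omega with coefficients in H^*(BT). *)
Theorem theorem4p2 :
  GKM tau /\ GKM omega /\
  forall f : vec -> P, GKM f ->
    exists cs : seq (P * nat * nat),
      (forall c, c \in cs -> HBT c.1.1) /\
      (forall v, inLambda v ->
         f v = \sum_(c <- cs) c.1.1 * tau v ^+ c.1.2 * omega v ^+ c.2).
Proof.
split; first exact: GKM_tau.
split; first exact: GKM_omega.
apply: flow_criterion => p; rewrite vtx_okE.
by case: p => [[i|[i j]]|i] h; [apply: flow_VA | apply: flow_VC | apply: flow_VB].
Qed.
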